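(* Let $\beta\in(\frac{1+\sqrt5}{2},2)$. Suppose the greedy $\beta$-expansion of $1$ is eventually periodic and that no point of the quasi-greedy orbit of $1$ lies in $(\beta^{-1},\beta^{-1}(\beta-1)^{-1}]$. Let $S'$ be the matrix constructed below. Then $\dim_H(U_\beta)=\frac{\log r}{\log\beta}$, where $r$ is the spectral radius of $S'$.
   Context: $U_\beta$ is the set of $x\in[0,(\beta-1)^{-1}]$ having a unique $\beta$-expansion, i.e. a unique $(a_n)\in\{0,1\}^{\mathbb{N}}$ with $x=\sum a_n\beta^{-n}$. The greedy map is $G(x)=\beta x\bmod1$ on $[0,1)$ and $G(x)=\beta x-1$ on $[1,(\beta-1)^{-1}]$. The quasi-greedy expansion $(\eta_i)$ of $1$ equals the greedy expansion of $1$ if that is infinite, and equals $(a_1\cdots a_{n-1}(a_n-1))^\infty$ if the greedy expansion is $a_1\cdots a_n0^\infty$ with $a_n=1$; the quasi-greedy orbit is $Q^i(1)=\sum_{j\ge1}\eta_{i+j}\beta^{-j}$, $i\ge1$. Construction of $S'$: let $\bar1=(2-\beta)(\beta-1)^{-1}$. Let $c_1<\dots<c_p$ be the (finitely many) values of the greedy orbits $\{G^n(1)\}_{n\ge0}$ and $\{G^n(\bar1)\}_{n\ge0}$ together with the points $0,\beta^{-1},\beta^{-1}(\beta-1)^{-1},1,(\beta-1)^{-1}$. Set $A_i=[c_i,c_{i+1}]$, $1\le i\le p-1$. For each $i$, let $T^{(i)}=T_1(x)=\beta x-1$ if $A_i\subseteq[\beta^{-1},(\beta-1)^{-1}]$ and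 $T^{(i)}=T_0(x)=\beta x$ otherwise; then $T^{(i)}(A_i)$ is a union of intervals $A_j$. Let $S$ be the $(p-1)\times(p-1)$ matrix with $S_{ij}=1$ if $A_j\subseteq T^{(i)}(A_i)$ and $S_{ij}=0$ otherwise. The switch region $[\beta^{-1},\beta^{-1}(\beta-1)^{-1}]$ is one of the intervals, say $A_{i_0}$; $S'$ is obtained from $S$ by deleting row $i_0$ and column $i_0$. *)

(* Defs.v *)
From Stdlib Require Import Reals Lra Lia ZArith Arith Classical ClassicalEpsilon.
Open Scope R_scope.

Fixpoint rsum (n : nat) (f : nat -> R) : R :=
  match n with O => 0 | S k => rsum k f + f k end.

(* Greedy map on [0,(beta-1)^-1]. *)
Definition Gmap (beta x : R) : R :=
  if Rlt_dec x 1 then frac_part (beta * x) else beta * x - 1.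

(* Greedy digits of 1, 0-indexed: gdigit beta k = a_{k+1} = floor(beta * G^k(1)). *)
Definition gdigit (beta : R) (k : nat) : Z :=
  Int_part (beta * Nat.iter k (Gmap beta) 1).

Definition greedy_eventually_periodic (beta : R) : Prop :=
  exists N P : nat, (P > 0)%nat /\ forall k, (N <= k)%nat -> gdigit beta (k + P) = gdigit beta k.

(* Quasi-greedy expansion of 1 (0-indexed: eta k = eta_{k+1}). *)
Definition quasi_greedy (beta : R) (eta : nat -> Z) : Prop :=
  ((forall m, exists k, (m < k)%nat /\ gdigit beta k <> 0%Z) /\ forall k, eta k = gdigit beta k)
  \/
  (exists m : nat, gdigit beta m = 1%Z /\ (forall k, (m < k)%nat -> gdigit beta k = 0%Z) /\
     forall k, eta k = (if Nat.eqb (k mod (S m)) m then 0%Z else gdigit beta (k mod (S m)))).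

(* No point Q^i(1), i >= 1, of the quasi-greedy orbit lies in (beta^-1, beta^-1 (beta-1)^-1]. *)
Definition quasi_greedy_orbit_avoids (beta : R) : Prop :=
  forall eta, quasi_greedy beta eta ->
  forall (i : nat) (q : R), (1 <= i)%nat ->
    infinite_sum (fun j => IZR (eta (i + j)%nat) / beta ^ (S j)) q ->
    ~ (/ beta < q <= / beta * / (beta - 1)).

Definition b2R (b : bool) : R := if b then 1 else 0.

Definition is_expansion (beta x : R) (a : nat -> bool) : Prop :=
  infinite_sum (fun n => b2R (a n) / beta ^ (S n)) x.

Definition Ubeta (beta : R) (x : R) : Prop :=
  0 <= x <= / (beta - 1) /\
  (exists a, is_expansion beta x a) /\
  (forall a b, is_expansion beta x a -> is_expansion beta x b -> forall n, a n = b n).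

Definition hausdorff_null (s : R) (E : R -> Prop) : Prop :=
  forall delta eps, 0 < delta -> 0 < eps ->
  exists (U : nat -> R -> Prop) (d : nat -> R),
    (forall x, E x -> exists i, U i x) /\
    (forall i, 0 < d i <= delta /\ forall x y, U i x -> U i y -> Rabs (x - y) <= d i) /\
    exists S, infinite_sum (fun i => Rpower (d i) s) S /\ S < eps.

Definition hausdorff_dim (E : R -> Prop) (dim : R) : Prop :=
  (forall s, 0 <= s -> hausdorff_null s E -> dim <= s) /\
  (forall b, (forall s, 0 <= s -> hausdorff_null s E -> b <= s) -> b <= dim).

(* lambda = a + i b is a complex eigenvalue with eigenvector v + i w. *)
Definition is_eigenvalue (n : nat) (M : nat -> nat -> R) (a b : R) : Prop :=
  exists v w : nat -> R,
    (exists i, (i < n)%nat /\ (v i <> 0 \/ w i <> 0)) /\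
    forall i, (i < n)%nat ->
      rsum n (fun j => M i j * v j) = a * v i - b * w i /\
      rsum n (fun j => M i j * w j) = a * w i + b * v i.

Definition spectral_radius (n : nat) (M : nat -> nat -> R) (r : R) : Prop :=
  (exists a b, is_eigenvalue n M a b /\ sqrt (a ^ 2 + b ^ 2) = r) /\
  (forall a b, is_eigenvalue n M a b -> sqrt (a ^ 2 + b ^ 2) <= r).

Definition bar1 (beta : R) : R := (2 - beta) / (beta - 1).

Definition inC (beta x : R) : Prop :=
  (exists n, x = Nat.iter n (Gmap beta) 1) \/
  (exists n, x = Nat.iter n (Gmap beta) (bar1 beta)) \/
  x = 0 \/ x = / beta \/ x = / beta * / (beta - 1) \/ x = 1 \/ x = / (beta - 1).

Definition enumC (beta : R) (p : nat) (c : nat -> R) : Prop :=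
  (forall i, (1 <= i < p)%nat -> c i < c (S i)) /\
  (forall i, (1 <= i <= p)%nat -> inC beta (c i)) /\
  (forall x, inC beta x -> exists i, (1 <= i <= p)%nat /\ c i = x).

Definition inA (c : nat -> R) (i : nat) (x : R) : Prop := c i <= x <= c (S i).

Definition Tmap (beta : R) (c : nat -> R) (i : nat) (x : R) : R :=
  if excluded_middle_informative
       (forall y, inA c i y -> / beta <= y <= / (beta - 1))
  then beta * x - 1 else beta * x.

Definition Smat (beta : R) (c : nat -> R) (i j : nat) : R :=
  if excluded_middle_informative
       (forall x, inA c j x -> exists y, inA c i y /\ x = Tmap beta c i y)
  then 1 else 0.

(* index k in 0..p-3 of S' corresponds to index sidx i0 k in {1..p-1} \ {i0} *)
Definition sidx (i0 k : nat) : nat := if Nat.ltb (S k) i0 then S k else S (S k).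

Definition Sprime (beta : R) (c : nat -> R) (i0 : nat) (k l : nat) : R :=
  Smat beta c (sidx i0 k) (sidx i0 l).

(* Main.v *)
Require Import Defs.
From Stdlib Require Import Reals Lra Lia Arith List Sorted.
From Stdlib Require Import Classical ClassicalEpsilon Cantor.
From Coquelicot Require Import Rcomplements Complex.
Open Scope R_scope.

(* A point has a unique expansion iff its greedy orbit never meets the switch region.  The
   hypothesis on the quasi-greedy orbit makes the orbit of [bar1] the mirror image of that of
   [1], so the partition is a finite Markov partition in which the switch region is one cell.

   Upper bound: paths of length [m] avoiding that cell number at most a constant times
   [rho^m] for each [rho > r], and their cylinders have length of order [beta^-m].

   Lower bound, for [r > 1]: a nonnegative eigenvector of [S'] for [r] yields a continuous
   function [Phi] on the domain which satisfies [Phi(y) - Phi(x) = (Phi(T y) - Phi(T x)) / r]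
   on every cell but the switch region, where it is constant.  Since [T] expands by [beta],
   [Phi] is Hoelder of exponent [ln r / ln beta].  It takes only countably many values outside
   [U_beta], so it maps [U_beta] onto an interval up to a countable set, and small covers of
   [U_beta] would give covers of this interval of too small total length. *)

(** * Finite sums and subsequences *)

(** [S'] need not be irreducible, so it may have no strictly positive eigenvector. The two bounds
    therefore use different substitutes: from above, strictly positive supersolutions for every
    [rho > r]; from below, one nonnegative eigenvector for [r] itself. That eigenvector may vanish
    on many cells, but only its total mass is used.

    The point 0 is fixed, so the first cell is mapped over itself and [r >= 1]; hence [ln r >= 0].
    For [r = 1] the claimed dimension is 0 and there is nothing to bound from below; for [r > 1] the
    factor [1 / r] is a contraction, which is what produces [Phi].

    The orbit of 1 may still pass through the left end [/ beta] of the switch region. There the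
    greedy map and the branch of the cell to the left disagree, with values 0 and 1. Both are
    partition points, and [/ beta] is not in [U_beta], so the partition remains Markov and the
    coding of [U_beta] is unaffected.

    No measure is ever constructed: the eigenvector enters through its distribution function, and
    the mass distribution principle becomes a statement on lengths of open intervals covering a
    segment. *)

Lemma rsum_ext n f g : (forall i, (i < n)%nat -> f i = g i) -> rsum n f = rsum n g.
Proof.
  induction n as [|n IH]; intros H; simpl; [reflexivity|].
  rewrite IH by (intros; apply H; lia). rewrite H by lia. reflexivity.
Qed.

Lemma rsum_le n f g : (forall i, (i < n)%nat -> f i <= g i) -> rsum n f <= rsum n g.
Proof.
  induction n as [|n IH]; intros H; simpl; [lra|].
  apply Rplus_le_compat; [apply IH; intros; apply H; lia | apply H; lia].
Qed.

Lemma rsum_zero n : rsum n (fun _ => 0) = 0.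
Proof. induction n as [|n IH]; simpl; lra. Qed.

Lemma rsum_nonneg n f : (forall i, (i < n)%nat -> 0 <= f i) -> 0 <= rsum n f.
Proof. intros H. rewrite <- (rsum_zero n). apply rsum_le. exact H. Qed.

Lemma rsum_scal n k f : rsum n (fun i => k * f i) = k * rsum n f.
Proof. induction n as [|n IH]; simpl; [ring|]. rewrite IH. ring. Qed.

Lemma rsum_plus n f g : rsum n (fun i => f i + g i) = rsum n f + rsum n g.
Proof. induction n as [|n IH]; simpl; [ring|]. rewrite IH. ring. Qed.

Lemma rsum_term_le n f i :
  (forall j, (j < n)%nat -> 0 <= f j) -> (i < n)%nat -> f i <= rsum n f.
Proof.
  induction n as [|n IH]; intros H Hi; simpl; [lia|].
  assert (0 <= f n) by (apply H; lia).
  destruct (Nat.eq_dec i n) as [->|Hne].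
  - assert (0 <= rsum n f) by (apply rsum_nonneg; intros; apply H; lia). lra.
  - assert (f i <= rsum n f) by (apply IH; [intros; apply H; lia | lia]). lra.
Qed.

Lemma rsum_mono n m f : (forall i, 0 <= f i) -> (n <= m)%nat -> rsum n f <= rsum m f.
Proof.
  intros H Hnm. induction Hnm as [|m _ IH]; [lra|]. simpl. specialize (H m). lra.
Qed.

Lemma rsum_cv n (f : nat -> nat -> R) l :
  (forall i, (i < n)%nat -> Un_cv (fun k => f k i) (l i)) ->
  Un_cv (fun k => rsum n (f k)) (rsum n l).
Proof.
  induction n as [|n IH]; intros H; simpl.
  - intros eps Heps. exists 0%nat. intros. rewrite Rdist_eq. exact Heps.
  - apply CV_plus; [apply IH; intros; apply H; lia | apply H; lia].
Qed.

Lemma Un_cv_const a : Un_cv (fun _ => a) a.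
Proof. intros eps Heps. exists 0%nat. intros. rewrite Rdist_eq. exact Heps. Qed.

Lemma Un_cv_ext f g l : (forall n, f n = g n) -> Un_cv f l -> Un_cv g l.
Proof.
  intros E H eps Heps. destruct (H eps Heps) as [N HN]. exists N. intros n Hn.
  rewrite <- E. apply HN; exact Hn.
Qed.

Lemma bounded_choice n (P : nat -> R -> Prop) :
  (forall i, (i < n)%nat -> exists y, P i y) ->
  exists u, forall i, (i < n)%nat -> P i (u i).
Proof.
  intros H. exists (fun i => epsilon (inhabits 0) (P i)).
  intros i Hi. apply epsilon_spec, H, Hi.
Qed.

Lemma increasing_ge_id phi : (forall k, (phi k < phi (S k))%nat) -> forall k, (k <= phi k)%nat.
Proof. intros H k. induction k as [|k IH]; [lia|]. specialize (H k). lia. Qed.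

Lemma increasing_lt phi : (forall k, (phi k < phi (S k))%nat) ->
  forall a b, (a < b)%nat -> (phi a < phi b)%nat.
Proof. intros H a b Hab. induction Hab as [|b _ IH]; [apply H|]. specialize (H b). lia. Qed.

Lemma Un_cv_sub f l phi :
  (forall k, (phi k < phi (S k))%nat) -> Un_cv f l -> Un_cv (fun k => f (phi k)) l.
Proof.
  intros Hphi H eps Heps. destruct (H eps Heps) as [N HN]. exists N. intros k Hk.
  apply HN. pose proof (increasing_ge_id phi Hphi k). lia.
Qed.

(** [Bolzano_Weierstrass] provides only an accumulation point; the subsequence is built by
    repeatedly choosing, past the current index, a term within [1 / (k + 1)] of it. *)
Lemma convergent_subsequence f :
  (forall k, 0 <= f k <= 1) ->
  exists phi l, (forall k, (phi k < phi (S k))%nat) /\ Un_cv (fun k => f (phi k)) l.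
Proof.
  intros Hf.
  destruct (Bolzano_Weierstrass f (fun x => 0 <= x <= 1) (compact_P3 0 1) Hf) as [l Hl].
  assert (Hstep : forall N k, exists m, (N < m)%nat /\ Rabs (f m - l) < / INR (S k)).
  { intros N k.
    assert (Hpos : 0 < / INR (S k)) by (apply Rinv_0_lt_compat, lt_0_INR; lia).
    assert (Hn : neighbourhood (disc l (mkposreal _ Hpos)) l).
    { exists (mkposreal _ Hpos). intros x Hx. exact Hx. }
    destruct (Hl _ (S N) Hn) as [m [Hm1 Hm2]]. exists m. split; [lia|]. exact Hm2. }
  set (next := fun N k => epsilon (inhabits 0%nat)
                 (fun m => (N < m)%nat /\ Rabs (f m - l) < / INR (S k))).
  assert (Hnext : forall N k, (N < next N k)%nat /\ Rabs (f (next N k) - l) < / INR (S k)).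
  { intros N k. exact (epsilon_spec (inhabits 0%nat)
        (fun m => (N < m)%nat /\ Rabs (f m - l) < / INR (S k)) (Hstep N k)). }
  set (phi := fix phi k := match k with O => next O O | S j => next (phi j) (S j) end).
  exists phi, l. split.
  - intros k. apply (Hnext (phi k) (S k)).
  - intros eps Heps. destruct (archimed_cor1 eps Heps) as [N [HN1 HN2]].
    exists N. intros k Hk. unfold Rdist.
    assert (Hb : Rabs (f (phi k) - l) < / INR (S k)) by (destruct k; apply Hnext).
    assert (/ INR (S k) <= / INR N).
    { apply Rinv_le_contravar; [apply lt_0_INR; lia | apply le_INR; lia]. }
    lra.
Qed.

Lemma convergent_subsequence_vec n (f : nat -> nat -> R) :
  (forall k i, (i < n)%nat -> 0 <= f k i <= 1) ->
  exists phi v, (forall k, (phi k < phi (S k))%nat) /\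
    forall i, (i < n)%nat -> Un_cv (fun k => f (phi k) i) (v i).
Proof.
  induction n as [|n IH]; intros Hf.
  - exists (fun k => k), (fun _ => 0). split; [intros; lia | intros; lia].
  - destruct IH as (phi & v & Hphi & Hv); [intros; apply Hf; lia|].
    destruct (convergent_subsequence (fun k => f (phi k) n)) as (psi & l & Hpsi & Hl).
    { intros k. apply Hf. lia. }
    exists (fun k => phi (psi k)), (fun i => if Nat.eq_dec i n then l else v i). split.
    + intros k. apply increasing_lt; [exact Hphi | apply Hpsi].
    + intros i Hi. destruct (Nat.eq_dec i n) as [->|Hne]; [exact Hl|].
      apply (Un_cv_sub (fun k => f (phi k) i)); [exact Hpsi | apply Hv; lia].
Qed.

(* The Neumann series [sum_k M^k 1 / rho^k], which a positive supersolution for a smaller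
   [rho'] dominates up to a constant. *)
Lemma resolvent_exists n (M : nat -> nat -> R) rho' rho u' :
  (forall i j, (i < n)%nat -> (j < n)%nat -> 0 <= M i j) ->
  0 < rho' < rho ->
  (forall i, (i < n)%nat -> 1 <= u' i /\ rsum n (fun j => M i j * u' j) <= rho' * u' i) ->
  exists u, forall i, (i < n)%nat ->
    1 <= u i /\ rsum n (fun j => M i j * u j) = rho * (u i - 1).
Proof.
  intros HM Hrho Hu'.
  set (w := fix w k i := match k with
                         | O => 0
                         | S k => 1 + / rho * rsum n (fun j => M i j * w k j) end).
  (* [K] solves [K = 1 + K * rho' / rho], so the bound [w <= K * u'] reproduces itself under the
     recursion because [1 <= u']. *)
  set (K := rho / (rho - rho')).
  assert (Hir : 0 < / rho) by (apply Rinv_0_lt_compat; lra).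
  assert (HK : 0 < K) by (apply Rdiv_lt_0_compat; lra).
  assert (Hpos : forall k i, (i < n)%nat -> 0 <= w k i).
  { induction k as [|k IH]; intros i Hi; simpl; [lra|].
    assert (0 <= rsum n (fun j => M i j * w k j)).
    { apply rsum_nonneg. intros j Hj. apply Rmult_le_pos; auto. }
    assert (0 <= / rho * rsum n (fun j => M i j * w k j)) by (apply Rmult_le_pos; lra). lra. }
  assert (Hbd : forall k i, (i < n)%nat -> w k i <= K * u' i).
  { induction k as [|k IH]; intros i Hi; simpl.
    - destruct (Hu' i Hi). apply Rmult_le_pos; lra.
    - assert (H1 : rsum n (fun j => M i j * w k j) <= K * (rho' * u' i)).
      { apply Rle_trans with (rsum n (fun j => K * (M i j * u' j))).
        - apply rsum_le. intros j Hj.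
          replace (K * (M i j * u' j)) with (M i j * (K * u' j)) by ring.
          apply Rmult_le_compat_l; auto.
        - rewrite rsum_scal. apply Rmult_le_compat_l; [lra | apply Hu', Hi]. }
      assert (H2 : / rho * rsum n (fun j => M i j * w k j) <= / rho * (K * (rho' * u' i)))
        by (apply Rmult_le_compat_l; lra).
      assert (H3 : K * u' i - / rho * (K * (rho' * u' i)) = u' i).
      { unfold K. field. lra. }
      destruct (Hu' i Hi). lra. }
  assert (Hgrow : forall k i, (i < n)%nat -> w k i <= w (S k) i).
  { induction k as [|k IH]; intros i Hi.
    - apply (Hpos 1%nat i Hi).
    - change (1 + / rho * rsum n (fun j => M i j * w k j)
              <= 1 + / rho * rsum n (fun j => M i j * w (S k) j)).
      apply Rplus_le_compat_l, Rmult_le_compat_l; [lra|].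
      apply rsum_le. intros j Hj. apply Rmult_le_compat_l; auto. }
  destruct (bounded_choice n (fun i l => Un_cv (fun k => w k i) l)) as [u Hu].
  { intros i Hi. destruct (growing_cv (fun k => w k i)) as [l Hl].
    - intros k. apply Hgrow, Hi.
    - exists (K * u' i). intros x [k ->]. apply Hbd, Hi.
    - exists l. exact Hl. }
  exists u. intros i Hi.
  assert (Hlim : u i = 1 + / rho * rsum n (fun j => M i j * u j)).
  { apply UL_sequence with (fun k => w (S k) i).
    - apply (Un_cv_ext (fun k => w (k + 1)%nat i)).
      + intros k. f_equal. lia.
      + apply (CV_shift' (fun k => w k i) 1). apply Hu, Hi.
    - simpl. apply CV_plus; [apply Un_cv_const|].
      apply CV_mult; [apply Un_cv_const|].
      apply (rsum_cv n (fun k j => M i j * w k j)). intros j Hj.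
      apply CV_mult; [apply Un_cv_const | apply Hu, Hj]. }
  split.
  - apply Rle_cv_lim with (fun _ : nat => 1) (fun k => w (S k) i).
    + intros k. simpl.
      assert (0 <= / rho * rsum n (fun j => M i j * w k j)); [|lra].
      apply Rmult_le_pos; [lra|]. apply rsum_nonneg. intros j Hj. apply Rmult_le_pos; auto.
    + apply Un_cv_const.
    + apply (Un_cv_ext (fun k => w (k + 1)%nat i)).
      * intros k. f_equal. lia.
      * apply (CV_shift' (fun k => w k i) 1). apply Hu, Hi.
  - set (s := rsum n (fun j => M i j * u j)) in *.
    rewrite Hlim. field. lra.
Qed.

(** * Perron-Frobenius theory *)

(** Up to scaling, [1 <= u i] is just positivity; in this form [u] directly dominates the number of
    cylinders of length zero, one per cell. *)
Definition supersolution n (M : nat -> nat -> R) rho u :=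
  forall i, (i < n)%nat -> 1 <= u i /\ rsum n (fun j => M i j * u j) <= rho * u i.

Lemma max_ratio n (z u : nat -> R) :
  (0 < n)%nat -> (forall i, (i < n)%nat -> 0 < u i) ->
  exists m, (m < n)%nat /\ forall i, (i < n)%nat -> z i * u m <= z m * u i.
Proof.
  intros Hn Hu.
  assert (H : forall k, (k < n)%nat ->
            exists m, (m < n)%nat /\ forall i, (i <= k)%nat -> z i / u i <= z m / u m).
  { induction k as [|k IH]; intros Hk.
    - exists 0%nat. split; [exact Hk|]. intros i Hi. replace i with 0%nat by lia. lra.
    - destruct IH as (m & Hm & IH); [lia|].
      destruct (Rle_dec (z (S k) / u (S k)) (z m / u m)) as [Hle|Hgt].
      + exists m. split; [exact Hm|]. intros i Hi.
        destruct (Nat.eq_dec i (S k)) as [->|]; [exact Hle | apply IH; lia].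
      + exists (S k). split; [exact Hk|]. intros i Hi.
        destruct (Nat.eq_dec i (S k)) as [->|]; [lra|].
        assert (z i / u i <= z m / u m) by (apply IH; lia). lra. }
  destruct (H (n - 1)%nat) as (m & Hm & Hmax); [lia|].
  exists m. split; [exact Hm|]. intros i Hi.
  assert (Hui := Hu i Hi). assert (Hum := Hu m Hm).
  replace (z i * u m) with (z i / u i * (u i * u m)) by (field; lra).
  replace (z m * u i) with (z m / u m * (u i * u m)) by (field; lra).
  apply Rmult_le_compat_r; [apply Rmult_le_pos; lra | apply Hmax; lia].
Qed.

Lemma Cmod_rsum_le n (m v w : nat -> R) :
  (forall j, (j < n)%nat -> 0 <= m j) ->
  Cmod (rsum n (fun j => m j * v j), rsum n (fun j => m j * w j))
  <= rsum n (fun j => m j * Cmod (v j, w j)).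
Proof.
  induction n as [|n IH]; intros Hm; simpl.
  - change (0, 0) with (RtoC 0). rewrite Cmod_0. lra.
  - replace (rsum n (fun j => m j * v j) + m n * v n,
             rsum n (fun j => m j * w j) + m n * w n)
      with (Cplus (rsum n (fun j => m j * v j), rsum n (fun j => m j * w j))
                  (Cmult (RtoC (m n)) (v n, w n))).
    2:{ unfold Cplus, Cmult, RtoC; simpl. f_equal; ring. }
    eapply Rle_trans; [apply Cmod_triangle|].
    apply Rplus_le_compat; [apply IH; intros; apply Hm; lia|].
    rewrite Cmod_mult, Cmod_R, Rabs_pos_eq by (apply Hm; lia). lra.
Qed.

(** Collatz-Wielandt comparison at the index [m] where the ratio of [z], the moduli of the
    eigenvector, to [u] is largest: [|lambda| * z m <= sum M z <= (z m / u m) * sum M u <= rho * z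
    m]. *)
Lemma eigenvalue_le_of_supersolution n (M : nat -> nat -> R) rho u a b :
  (forall i j, (i < n)%nat -> (j < n)%nat -> 0 <= M i j) ->
  supersolution n M rho u -> is_eigenvalue n M a b -> sqrt (a ^ 2 + b ^ 2) <= rho.
Proof.
  intros HM Hu (v & w & (i0 & Hi0 & Hne) & Heig).
  set (z := fun i => Cmod (v i, w i)).
  destruct (max_ratio n z u) as (m & Hm & Hmax); [lia | intros i Hi; destruct (Hu i Hi); lra |].
  assert (Hum : 1 <= u m) by apply Hu, Hm.
  assert (Hz0 : 0 < z i0).
  { apply Cmod_gt_0. intros E. injection E as E1 E2. destruct Hne; contradiction. }
  assert (Hzm : 0 < z m).
  { assert (H := Hmax i0 Hi0). assert (1 <= u i0) by apply Hu, Hi0.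
    assert (0 < z i0 * u m) by (apply Rmult_lt_0_compat; lra).
    apply Rnot_le_lt. intros Hc. assert (z m * u i0 <= 0 * u i0); [|lra].
    apply Rmult_le_compat_r; lra. }
  change (sqrt (a ^ 2 + b ^ 2)) with (Cmod (a, b)).
  assert (H1 : Cmod (a, b) * z m <= rsum n (fun j => M m j * z j)).
  { unfold z at 1. rewrite <- Cmod_mult.
    destruct (Heig m Hm) as [E1 E2].
    replace (Cmult (a, b) (v m, w m))
      with (rsum n (fun j => M m j * v j), rsum n (fun j => M m j * w j)).
    - apply Cmod_rsum_le. intros j Hj. auto.
    - rewrite E1, E2. unfold Cmult. simpl. f_equal; ring. }
  assert (H2 : rsum n (fun j => M m j * z j) * u m <= z m * (rho * u m)).
  { apply Rle_trans with (z m * rsum n (fun j => M m j * u j)).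
    - rewrite (Rmult_comm _ (u m)), <- !rsum_scal. apply rsum_le. intros j Hj.
      replace (u m * (M m j * z j)) with (M m j * (z j * u m)) by ring.
      replace (z m * (M m j * u j)) with (M m j * (z m * u j)) by ring.
      apply Rmult_le_compat_l; auto.
    - apply Rmult_le_compat_l; [lra | apply Hu, Hm]. }
  apply Rmult_le_reg_r with (z m * u m); [apply Rmult_lt_0_compat; lra|].
  replace (Cmod (a, b) * (z m * u m)) with (Cmod (a, b) * z m * u m) by ring.
  apply Rle_trans with (rsum n (fun j => M m j * z j) * u m); [|lra].
  apply Rmult_le_compat_r; lra.
Qed.

(* [r] is the infimum of the [rho] admitting a positive supersolution.  The resolvents
   [u_rho] blow up as [rho] decreases to [r], for otherwise they would be supersolutions for
   some [rho < r]; normalised, they accumulate at an eigenvector for [r]. *)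
Theorem perron_frobenius n (M : nat -> nat -> R) i0 :
  (forall i j, (i < n)%nat -> (j < n)%nat -> 0 <= M i j) ->
  (i0 < n)%nat -> 1 <= M i0 i0 ->
  exists r v, 1 <= r /\
    (forall rho, r < rho -> exists u, supersolution n M rho u) /\
    (forall i, (i < n)%nat -> 0 <= v i) /\ rsum n v = 1 /\
    forall i, (i < n)%nat -> rsum n (fun j => M i j * v j) = r * v i.
Proof.
  intros HM Hi0 Hdiag.
  (* The diagonal entry alone forces [rho >= 1]. This bounds the set of admissible [rho] from below
     and excludes the nilpotent case [r = 0]. *)
  assert (Hge1 : forall rho u, supersolution n M rho u -> 1 <= rho).
  { intros rho u Hu. destruct (Hu i0 Hi0) as [H1 H2].
    assert (M i0 i0 * u i0 <= rsum n (fun j => M i0 j * u j)).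
    { apply (rsum_term_le n (fun j => M i0 j * u j)); [|exact Hi0].
      intros j Hj. destruct (Hu j Hj). apply Rmult_le_pos; [auto|lra]. }
    apply Rmult_le_reg_r with (u i0); [lra|].
    apply Rle_trans with (M i0 i0 * u i0); [apply Rmult_le_compat_r|]; lra. }
  (* The sum of all entries bounds every row sum, so the constant vector 1 shows that some [rho] is
     admissible. *)
  set (T := rsum n (fun i => rsum n (M i))).
  assert (HT : supersolution n M T (fun _ => 1)).
  { intros i Hi. split; [lra|].
    rewrite (rsum_ext n _ (M i)) by (intros; ring). rewrite Rmult_1_r.
    apply (rsum_term_le n (fun i => rsum n (M i))); [|exact Hi].
    intros j Hj. apply rsum_nonneg. auto. }
  (* [completeness] yields suprema, hence the infimum is taken as minus the supremum of the
     negatives. *)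
  destruct (completeness (fun y => exists u, supersolution n M (- y) u)) as [y [Hub Hlub]].
  { exists (-1). intros y [u Hu]. apply Hge1 in Hu. lra. }
  { exists (- T), (fun _ => 1). rewrite Ropp_involutive. exact HT. }
  set (r := - y).
  assert (Hinf : forall rho u, supersolution n M rho u -> r <= rho).
  { intros rho u Hu. assert (- rho <= y); [|unfold r; lra].
    apply Hub. exists u. rewrite Ropp_involutive. exact Hu. }
  assert (Hr1 : 1 <= r).
  { assert (y <= -1); [|unfold r; lra]. apply Hlub. intros x [u Hu].
    apply Hge1 in Hu. lra. }
  assert (Hnear : forall rho, r < rho -> exists rho' u, rho' < rho /\ supersolution n M rho' u).
  { intros rho Hrho. apply NNPP. intros Hc.
    assert (y <= - rho); [|unfold r in Hrho; lra].
    apply Hlub. intros x [u Hu]. apply Rnot_lt_le. intros Hlt. apply Hc.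
    exists (- x), u. split; [lra|exact Hu]. }
  assert (Hres : forall k, exists u, forall i, (i < n)%nat ->
     1 <= u i /\ rsum n (fun j => M i j * u j) = (r + / INR (S k)) * (u i - 1)).
  { intros k. assert (0 < / INR (S k)) by (apply Rinv_0_lt_compat, lt_0_INR; lia).
    destruct (Hnear (r + / INR (S k))) as (rho' & u' & Hlt & Hu'); [lra|].
    apply (resolvent_exists n M rho' _ u'); [exact HM | | exact Hu'].
    apply Hge1 in Hu'. lra. }
  destruct (ClassicalEpsilon.choice _ Hres) as [u Hu].
  set (s := fun k => rsum n (u k)).
  assert (Hu0 : forall k i, (i < n)%nat -> 1 <= u k i) by (intros; apply Hu; auto).
  assert (Hus : forall k i, (i < n)%nat -> u k i <= s k).
  { intros k i Hi. apply rsum_term_le; [|exact Hi]. intros j Hj. specialize (Hu0 k j Hj). lra. }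
  assert (Hs1 : forall k, 1 <= s k).
  { intros k. eapply Rle_trans; [apply (Hu0 k i0 Hi0) | apply Hus, Hi0]. }
  (* If [s] stayed below [B], then [u k i <= B] would give [u - 1 <= (1 - 1 / B) * u], making [u k]
     a supersolution for [(r + 1 / (k + 1)) * (1 - 1 / B)], which is below [r] once
     [1 / (k + 1) < r / B]. *)
  assert (Hblow : forall N B, exists k, (N < k)%nat /\ B < s k).
  { intros N B0. apply NNPP. intros Hc.
    set (B := Rmax 1 B0). assert (HB1 : 1 <= B) by apply Rmax_l.
    assert (Hsb : forall k, (N < k)%nat -> s k <= B).
    { intros k Hk. apply Rnot_lt_le. intros Hlt. apply Hc. exists k. split; [exact Hk|].
      apply Rle_lt_trans with B; [apply Rmax_r | exact Hlt]. }
    assert (HiB : 0 < / B <= 1).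
    { split; [apply Rinv_0_lt_compat; lra|]. rewrite <- Rinv_1. apply Rinv_le_contravar; lra. }
    assert (Hk : forall k, (N < k)%nat -> r <= (r + / INR (S k)) * (1 - / B)).
    { intros k Hk. apply (Hinf _ (u k)). intros i Hi.
      destruct (Hu k i Hi) as [H1 H2]. split; [exact H1|]. rewrite H2.
      assert (0 < / INR (S k)) by (apply Rinv_0_lt_compat, lt_0_INR; lia).
      rewrite Rmult_assoc. apply Rmult_le_compat_l; [lra|].
      assert (/ B * u k i <= 1); [|lra].
      rewrite <- (Rinv_l B) by lra. apply Rmult_le_compat_l; [lra|].
      eapply Rle_trans; [apply Hus, Hi | apply Hsb, Hk]. }
    assert (HrB : 0 < r * / B) by (apply Rmult_lt_0_compat; lra).
    destruct (archimed_cor1 _ HrB) as [m [Hm1 Hm2]].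
    assert (Hk' := Hk (N + m)%nat ltac:(lia)).
    assert (/ INR (S (N + m)) <= / INR m).
    { apply Rinv_le_contravar; [apply lt_0_INR; lia | apply le_INR; lia]. }
    assert (0 < / INR (S (N + m))) by (apply Rinv_0_lt_compat, lt_0_INR; lia).
    assert (/ INR (S (N + m)) * (1 - / B) <= / INR (S (N + m)) * 1)
      by (apply Rmult_le_compat_l; lra).
    lra. }
  assert (Hsel : forall m, exists k, (m < k)%nat /\ INR (S m) < s k) by (intros; apply Hblow).
  destruct (ClassicalEpsilon.choice _ Hsel) as [q Hq].
  destruct (convergent_subsequence_vec n (fun m i => u (q m) i / s (q m)))
    as (phi & v & Hphi & Hv).
  { intros m i Hi. specialize (Hu0 (q m) i Hi). specialize (Hus (q m) i Hi).
    specialize (Hs1 (q m)). split.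
    - apply Rmult_le_pos; [lra|]. left. apply Rinv_0_lt_compat. lra.
    - apply Rmult_le_reg_r with (s (q m)); [lra|]. unfold Rdiv. rewrite Rmult_assoc, Rinv_l; lra. }
  assert (Hinv : Un_cv (fun k => / INR (S k)) 0).
  { intros eps Heps. destruct (archimed_cor1 eps Heps) as [N [HN1 HN2]].
    exists N. intros k Hk. unfold Rdist. rewrite Rminus_0_r.
    assert (0 < / INR (S k)) by (apply Rinv_0_lt_compat, lt_0_INR; lia).
    rewrite Rabs_pos_eq by lra.
    apply Rle_lt_trans with (/ INR N); [|exact HN1].
    apply Rinv_le_contravar; [apply lt_0_INR; lia | apply le_INR; lia]. }
  assert (Hphik := increasing_ge_id phi Hphi).
  assert (Hdom : forall (f : nat -> R), (forall k, 0 <= f k <= / INR (S k)) -> Un_cv f 0).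
  { intros f Hf eps Heps. destruct (Hinv eps Heps) as [N HN]. exists N. intros k Hk.
    specialize (HN k Hk). unfold Rdist in *. rewrite Rminus_0_r in *.
    destruct (Hf k). rewrite Rabs_pos_eq in * by lra. lra. }
  assert (Hrho0 : Un_cv (fun k => / INR (S (q (phi k)))) 0).
  { apply Hdom. intros k. split.
    - left. apply Rinv_0_lt_compat, lt_0_INR. lia.
    - apply Rinv_le_contravar; [apply lt_0_INR; lia | apply le_INR].
      specialize (Hphik k). destruct (Hq (phi k)). lia. }
  assert (Hs0 : Un_cv (fun k => / s (q (phi k))) 0).
  { apply Hdom. intros k. specialize (Hs1 (q (phi k))). split.
    - left. apply Rinv_0_lt_compat. lra.
    - apply Rinv_le_contravar; [apply lt_0_INR; lia|].
      destruct (Hq (phi k)) as [_ H]. assert (INR (S k) <= INR (S (phi k))).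
      { apply le_INR. specialize (Hphik k). lia. } lra. }
  exists r, v. split; [exact Hr1|]. split; [|split; [|split]].
  - intros rho Hrho. destruct (Hnear rho Hrho) as (rho' & u' & Hlt & Hu').
    exists u'. intros i Hi. destruct (Hu' i Hi). split; [assumption|].
    apply Rle_trans with (rho' * u' i); [assumption|]. apply Rmult_le_compat_r; lra.
  - intros i Hi. apply Rle_cv_lim with (fun _ : nat => 0) (fun k => u (q (phi k)) i / s (q (phi k))).
    + intros k. specialize (Hu0 (q (phi k)) i Hi). specialize (Hs1 (q (phi k))).
      apply Rmult_le_pos; [lra|]. left. apply Rinv_0_lt_compat. lra.
    + apply Un_cv_const.
    + apply Hv, Hi.
  - apply UL_sequence with (fun k => rsum n (fun i => u (q (phi k)) i / s (q (phi k)))).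
    + apply (rsum_cv n (fun k i => u (q (phi k)) i / s (q (phi k)))). exact Hv.
    + apply (Un_cv_ext (fun _ => 1)); [|apply Un_cv_const]. intros k.
      rewrite (rsum_ext n _ (fun i => / s (q (phi k)) * u (q (phi k)) i))
        by (intros; unfold Rdiv; ring).
      rewrite rsum_scal. symmetry.
      assert (H : s (q (phi k)) <> 0) by (specialize (Hs1 (q (phi k))); lra).
      exact (Rinv_l _ H).
  - intros i Hi.
    apply UL_sequence with
      (fun k => rsum n (fun j => M i j * (u (q (phi k)) j / s (q (phi k))))).
    + apply (rsum_cv n (fun k j => M i j * (u (q (phi k)) j / s (q (phi k))))). intros j Hj.
      apply CV_mult; [apply Un_cv_const | apply Hv, Hj].
    (* Dividing the resolvent equation by [s] turns its inhomogeneous term into [1 / s], which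
       vanishes in the limit and leaves an exact eigenvector equation. *)
    + apply (Un_cv_ext (fun k => (r + / INR (S (q (phi k))))
                 * (u (q (phi k)) i / s (q (phi k)) - / s (q (phi k))))).
      * intros k.
        rewrite (rsum_ext n _ (fun j => / s (q (phi k)) * (M i j * u (q (phi k)) j)))
          by (intros; unfold Rdiv; ring).
        rewrite rsum_scal. destruct (Hu (q (phi k)) i Hi) as [_ ->]. unfold Rdiv. ring.
      * replace (r * v i) with ((r + 0) * (v i - 0)) by ring.
        apply CV_mult; [apply CV_plus; [apply Un_cv_const | exact Hrho0]|].
        apply CV_minus; [apply Hv, Hi | exact Hs0].
Qed.

Lemma spectral_radius_of_perron n (M : nat -> nat -> R) r v :
  (forall i j, (i < n)%nat -> (j < n)%nat -> 0 <= M i j) -> 0 <= r ->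
  (forall rho, r < rho -> exists u, supersolution n M rho u) ->
  rsum n v = 1 ->
  (forall i, (i < n)%nat -> rsum n (fun j => M i j * v j) = r * v i) ->
  spectral_radius n M r.
Proof.
  intros HM Hr Hsup Hv1 Hv. split.
  - exists r, 0. split.
    + exists v, (fun _ => 0). split.
      * apply NNPP. intros Hc. assert (E : rsum n v = rsum n (fun _ => 0)).
        { apply rsum_ext. intros i Hi. apply NNPP. intros Hne. apply Hc. exists i. auto. }
        rewrite rsum_zero in E. lra.
      * intros i Hi. rewrite (Hv i Hi).
        rewrite (rsum_ext n (fun j => M i j * 0) (fun _ => 0)) by (intros; ring).
        rewrite rsum_zero. split; ring.
    + replace (r ^ 2 + 0 ^ 2) with (r * r) by ring. apply sqrt_square, Hr.
  - intros a b Hab. apply Rnot_lt_le. intros Hlt.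
    destruct (Hsup ((r + sqrt (a ^ 2 + b ^ 2)) / 2)) as [u Hu]; [lra|].
    assert (H := eigenvalue_le_of_supersolution n M _ u a b HM Hu Hab). lra.
Qed.

(** * Expansions and the greedy map *)

(** The second inequality says that [beta] exceeds the positive root of [x^2 = x + 1], free of
    square roots. Equivalently, the switch region ends before 1. *)
Definition above_golden beta := 1 < beta < 2 /\ 1 < beta * (beta - 1).

(** These are the points at which both digits are possible: [beta * x] and [beta * x - 1] both stay
    in the domain. *)
Definition switch beta x := / beta <= x <= / beta * / (beta - 1).

Definition domain beta x := 0 <= x <= / (beta - 1).

Lemma golden_bound beta : (1 + sqrt 5) / 2 < beta < 2 -> above_golden beta.
Proof.
  intros [H1 H2].
  assert (Hs : sqrt 5 * sqrt 5 = 5) by (apply sqrt_sqrt; lra).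
  assert (H0 : 0 <= sqrt 5) by apply sqrt_pos.
  assert (1 < sqrt 5) by (apply Rnot_le_lt; intros Hc; nra).
  split; [lra|]. nra.
Qed.

(** Products of inverses are turned into sums, so that later arguments are linear in [/ beta] and
    [L = / (beta - 1)]. The switch region becomes [[/ beta, L - / beta]]: symmetric under
    [x |-> L - x], nondegenerate, and to the left of 1. *)
Lemma above_golden_facts beta : above_golden beta ->
  1 < beta < 2 /\ 0 < / beta < 1 /\ beta * / beta = 1 /\
  beta * / (beta - 1) = / (beta - 1) + 1 /\
  / beta * / (beta - 1) = / (beta - 1) - / beta /\
  1 < / (beta - 1) < 1 + / beta /\ 2 * / beta < / (beta - 1).
Proof.
  intros [[H1 H2] H3].
  assert (Hi : 0 < / beta) by (apply Rinv_0_lt_compat; lra).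
  assert (HL : 0 < / (beta - 1)) by (apply Rinv_0_lt_compat; lra).
  assert (E1 : beta * / beta = 1) by (field; lra).
  assert (E2 : beta * / (beta - 1) = / (beta - 1) + 1) by (field; lra).
  assert (E3 : / beta * / (beta - 1) = / (beta - 1) - / beta) by (field; lra).
  assert (E4 : (beta - 1) * / (beta - 1) = 1) by (field; lra).
  assert (/ beta < 1) by nra.
  assert (1 < / (beta - 1)) by nra.
  assert (/ (beta - 1) * / beta < 1).
  { assert (/ (beta - 1) * / beta * (beta * (beta - 1)) = 1) by (field; lra).
    assert (0 < / (beta - 1) * / beta) by (apply Rmult_lt_0_compat; lra). nra. }
  repeat split; try lra. nra.
Qed.

Lemma mul_beta_lt beta x y : 0 < beta -> x < y -> beta * x < beta * y.
Proof. intros. apply Rmult_lt_compat_l; assumption. Qed.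

Lemma mul_beta_le beta x y : 0 < beta -> x <= y -> beta * x <= beta * y.
Proof. intros. apply Rmult_le_compat_l; lra. Qed.

Lemma Int_part_unique x z : IZR z <= x < IZR z + 1 -> Int_part x = z.
Proof. intros H. symmetry. apply Int_part_spec. lra. Qed.

Lemma Gmap_low beta x : above_golden beta -> 0 <= x < / beta -> Gmap beta x = beta * x.
Proof.
  intros Hg Hx. destruct (above_golden_facts beta Hg) as (Hb & Hi & E1 & _).
  unfold Gmap. destruct (Rlt_dec x 1); [|lra].
  assert (beta * x < beta * / beta) by (apply mul_beta_lt; lra).
  assert (0 <= beta * x) by (apply Rmult_le_pos; lra).
  unfold frac_part. rewrite (Int_part_unique _ 0); lra.
Qed.

Lemma Gmap_high beta x : above_golden beta -> / beta <= x -> Gmap beta x = beta * x - 1.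
Proof.
  intros Hg Hx. destruct (above_golden_facts beta Hg) as (Hb & Hi & E1 & _).
  unfold Gmap. destruct (Rlt_dec x 1); [|reflexivity].
  assert (beta * / beta <= beta * x) by (apply mul_beta_le; lra).
  assert (beta * x < beta * 1) by (apply mul_beta_lt; lra).
  unfold frac_part. rewrite (Int_part_unique _ 1); lra.
Qed.

Definition digit beta x : bool := if Rlt_dec x (/ beta) then false else true.

Lemma Gmap_digit beta x : above_golden beta -> 0 <= x ->
  Gmap beta x = beta * x - b2R (digit beta x).
Proof.
  intros Hg Hx. unfold digit. destruct (Rlt_dec x (/ beta)); simpl.
  - rewrite Gmap_low by auto. ring.
  - rewrite Gmap_high by (auto; lra). ring.
Qed.

Lemma Gmap_domain beta x : above_golden beta -> domain beta x -> domain beta (Gmap beta x).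
Proof.
  intros Hg [H0 HL]. destruct (above_golden_facts beta Hg) as (Hb & Hi & E1 & E2 & E3 & HL1 & _).
  destruct (Rlt_le_dec x (/ beta)) as [Hlt|Hge].
  - rewrite Gmap_low by auto.
    assert (beta * x < beta * / beta) by (apply mul_beta_lt; lra).
    assert (0 <= beta * x) by (apply Rmult_le_pos; lra). unfold domain. lra.
  - rewrite Gmap_high by auto.
    assert (beta * / beta <= beta * x) by (apply mul_beta_le; lra).
    assert (beta * x <= beta * / (beta - 1)) by (apply mul_beta_le; lra). unfold domain. lra.
Qed.

Lemma orbit_domain beta x n : above_golden beta -> domain beta x ->
  domain beta (Nat.iter n (Gmap beta) x).
Proof.
  intros Hg Hx. induction n as [|n IH]; simpl; [exact Hx | apply Gmap_domain; assumption].
Qed.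

(** This is [beta ^ n] times the error of the [n]-th partial sum, so convergence of an expansion
    becomes a growth condition on an orbit. *)
Fixpoint remainder beta (e : nat -> R) x n :=
  match n with O => x | S n => beta * remainder beta e x n - e n end.

Lemma remainder_sum beta e x n : 0 < beta ->
  sum_f_R0 (fun j => e j / beta ^ S j) n = x - remainder beta e x (S n) / beta ^ S n.
Proof.
  intros Hb. assert (Hp : forall k, beta ^ k <> 0) by (intros; apply pow_nonzero; lra).
  induction n as [|n IH].
  - simpl. field. lra.
  - rewrite tech5, IH.
    change (remainder beta e x (S (S n))) with (beta * remainder beta e x (S n) - e (S n)).
    change (beta ^ S (S n)) with (beta * beta ^ S n). field. split; [apply Hp | lra].
Qed.

Lemma inv_pow_small beta eps : 1 < beta -> 0 < eps ->
  exists N, forall n, (N <= n)%nat -> / beta ^ n < eps.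
Proof.
  intros Hb Heps.
  assert (0 < / beta) by (apply Rinv_0_lt_compat; lra).
  destruct (pow_lt_1_zero (/ beta)) with (y := eps) as [N HN].
  - rewrite Rabs_pos_eq by lra. rewrite <- Rinv_1. apply Rinv_lt_contravar; lra.
  - exact Heps.
  - exists N. intros n Hn. specialize (HN n Hn). rewrite pow_inv in HN.
    apply Rle_lt_trans with (Rabs (/ beta ^ n)); [apply Rle_abs | exact HN].
Qed.

(** The error of the partial sums is [z (S n) / beta ^ S n], which a bound on [z] sends to 0. It
    applies to greedy and quasi-greedy orbits alike. *)
Lemma infinite_sum_of_bounded_orbit beta (e z : nat -> R) B :
  1 < beta -> (forall n, Rabs (z n) <= B) -> (forall n, z (S n) = beta * z n - e n) ->
  infinite_sum (fun j => e j / beta ^ S j) (z 0%nat).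
Proof.
  intros Hb HB Hz.
  assert (Er : forall n, remainder beta e (z 0%nat) n = z n).
  { induction n as [|n IH]; [reflexivity|]. simpl. rewrite IH. symmetry. apply Hz. }
  assert (HB0 : 0 <= B) by (eapply Rle_trans; [apply Rabs_pos | apply (HB 0%nat)]).
  intros eps Heps.
  destruct (inv_pow_small beta (eps / (B + 1)) Hb) as [N HN].
  { apply Rdiv_lt_0_compat; lra. }
  exists N. intros n Hn. rewrite remainder_sum with (x := z 0%nat), Er by lra. unfold Rdist.
  replace (z 0%nat - z (S n) / beta ^ S n - z 0%nat) with (- (z (S n) * / beta ^ S n))
    by (unfold Rdiv; ring).
  rewrite Rabs_Ropp, Rabs_mult.
  assert (Hpos : 0 < / beta ^ S n) by (apply Rinv_0_lt_compat, pow_lt; lra).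
  rewrite (Rabs_pos_eq (/ _)) by lra.
  specialize (HN (S n) ltac:(lia)).
  apply Rle_lt_trans with ((B + 1) * / beta ^ S n).
  - apply Rmult_le_compat_r; [lra|]. specialize (HB (S n)). lra.
  - replace eps with ((B + 1) * (eps / (B + 1))) by (field; lra).
    apply Rmult_lt_compat_l; lra.
Qed.

(* Outside the domain the remainders diverge at rate [beta^n]. *)
Lemma is_expansion_iff beta x a : 1 < beta ->
  is_expansion beta x a <->
  forall n, domain beta (remainder beta (fun k => b2R (a k)) x n).
Proof.
  intros Hb. set (y := remainder beta (fun k => b2R (a k)) x).
  assert (HyS : forall n, y (S n) = beta * y n - b2R (a n)) by reflexivity.
  assert (HL : 0 < / (beta - 1)) by (apply Rinv_0_lt_compat; lra).
  assert (E2 : beta * / (beta - 1) = / (beta - 1) + 1) by (field; lra).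
  assert (Ha : forall k, 0 <= b2R (a k) <= 1) by (intros k; unfold b2R; destruct (a k); lra).
  split.
  - intros Hsum.
    (* Convergence says that remainders are [o(beta ^ k)], counted from any index [n]; a remainder
       outside the domain moves away from it by a factor of at least [beta] per step. *)
    assert (Hsmall : forall n c, 0 < c -> exists k, Rabs (y (n + k)%nat) < c * beta ^ k).
    { intros n c Hc.
      assert (Hp : 0 < beta ^ n) by (apply pow_lt; lra).
      destruct (Hsum (c / beta ^ n)) as [N HN]; [apply Rdiv_lt_0_compat; lra|].
      specialize (HN (n + N)%nat ltac:(lia)).
      rewrite remainder_sum with (x := x) in HN by lra.
      fold y in HN. unfold Rdist in HN.
      replace (x - y (S (n + N)) / beta ^ S (n + N) - x)
        with (- (y (S (n + N)) / beta ^ S (n + N))) in HN by ring.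
      rewrite Rabs_Ropp in HN. exists (S N).
      replace (S (n + N)) with (n + S N)%nat in HN by lia.
      assert (Hpk : 0 < beta ^ (n + S N)) by (apply pow_lt; lra).
      unfold Rdiv in HN. rewrite Rabs_mult, (Rabs_pos_eq (/ beta ^ (n + S N))) in HN
        by (left; apply Rinv_0_lt_compat; exact Hpk).
      apply Rmult_lt_reg_r with (/ beta ^ (n + S N)); [apply Rinv_0_lt_compat; exact Hpk|].
      eapply Rlt_le_trans; [exact HN|]. right. rewrite pow_add. field.
      split; apply pow_nonzero; lra. }
    intros n. split; apply Rnot_lt_le; intros Hc.
    + destruct (Hsmall n (- y n) ltac:(lra)) as [k Hk].
      assert (H : y (n + k)%nat <= y n * beta ^ k).
      { clear Hk. induction k as [|k IH]; [rewrite Nat.add_0_r; simpl; lra|].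
        rewrite Nat.add_succ_r, HyS. simpl. specialize (Ha (n + k)%nat).
        assert (beta * y (n + k)%nat <= beta * (y n * beta ^ k)) by (apply mul_beta_le; lra).
        lra. }
      assert (0 < beta ^ k) by (apply pow_lt; lra).
      assert (- y (n + k)%nat <= Rabs (y (n + k)%nat)).
      { rewrite <- Rabs_Ropp. apply Rle_abs. }
      lra.
    + destruct (Hsmall n (y n - / (beta - 1)) ltac:(lra)) as [k Hk].
      assert (H : (y n - / (beta - 1)) * beta ^ k <= y (n + k)%nat - / (beta - 1)).
      { clear Hk. induction k as [|k IH]; [rewrite Nat.add_0_r; simpl; lra|].
        rewrite Nat.add_succ_r, HyS. simpl. specialize (Ha (n + k)%nat).
        assert (beta * ((y n - / (beta - 1)) * beta ^ k)
                <= beta * (y (n + k)%nat - / (beta - 1))) by (apply mul_beta_le; lra).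
        lra. }
      assert (y (n + k)%nat <= Rabs (y (n + k)%nat)) by apply Rle_abs.
      lra.
  - intros H. apply (infinite_sum_of_bounded_orbit beta (fun k => b2R (a k)) y (/ (beta - 1))).
    + exact Hb.
    + intros n. destruct (H n). rewrite Rabs_pos_eq; assumption.
    + reflexivity.
Qed.

Definition prepend (d : bool) (a : nat -> bool) (n : nat) : bool :=
  match n with O => d | S n => a n end.

Lemma is_expansion_prepend beta x d a : 1 < beta -> domain beta x ->
  is_expansion beta (beta * x - b2R d) a -> is_expansion beta x (prepend d a).
Proof.
  intros Hb Hx. rewrite !is_expansion_iff by exact Hb. intros H.
  assert (E : forall n, remainder beta (fun k => b2R (prepend d a k)) x (S n)
              = remainder beta (fun k => b2R (a k)) (beta * x - b2R d) n).
  { induction n as [|n IH]; [reflexivity|].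
    change (beta * remainder beta (fun k => b2R (prepend d a k)) x (S n) - b2R (a n)
      = beta * remainder beta (fun k => b2R (a k)) (beta * x - b2R d) n - b2R (a n)).
    rewrite IH. reflexivity. }
  intros [|n]; [exact Hx | rewrite E; apply H].
Qed.

Lemma greedy_expansion beta x : above_golden beta -> domain beta x ->
  is_expansion beta x (fun n => digit beta (Nat.iter n (Gmap beta) x)).
Proof.
  intros Hg Hx. assert (1 < beta) by apply Hg. apply is_expansion_iff; [assumption|].
  intros n. replace (remainder _ _ _ n) with (Nat.iter n (Gmap beta) x);
    [apply orbit_domain; assumption|].
  induction n as [|n IH]; [reflexivity|]. simpl. rewrite <- IH.
  apply Gmap_digit; [exact Hg|]. apply (orbit_domain beta x n Hg Hx).
Qed.

(** Both possible successors have a greedy expansion; prepending the respective digit gives two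
    expansions that differ at once. *)
Lemma Ubeta_not_switch beta x : above_golden beta -> Ubeta beta x -> ~ switch beta x.
Proof.
  intros Hg (Hx & _ & Huniq) [H1 H2].
  destruct (above_golden_facts beta Hg) as (Hb & Hi & E1 & E2 & E3 & _).
  assert (beta * / beta <= beta * x) by (apply mul_beta_le; lra).
  assert (beta * x <= beta * (/ (beta - 1) - / beta)) by (apply mul_beta_le; lra).
  assert (Hf : domain beta (beta * x - b2R false)) by (unfold domain; simpl; lra).
  assert (Ht : domain beta (beta * x - b2R true)) by (unfold domain; simpl; lra).
  assert (E := Huniq _ _
     (is_expansion_prepend beta x false _ (proj1 Hb) Hx (greedy_expansion beta _ Hg Hf))
     (is_expansion_prepend beta x true _ (proj1 Hb) Hx (greedy_expansion beta _ Hg Ht)) 0%nat).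
  discriminate E.
Qed.

Lemma Ubeta_Gmap beta x : above_golden beta -> Ubeta beta x -> Ubeta beta (Gmap beta x).
Proof.
  intros Hg (Hx & _ & Huniq).
  assert (HGx : domain beta (Gmap beta x)) by (apply Gmap_domain; assumption).
  split; [exact HGx|]. split; [exists (fun n => digit beta (Nat.iter n (Gmap beta) (Gmap beta x)));
                                apply greedy_expansion; assumption|].
  intros a b Ha Hb n. rewrite Gmap_digit in Ha, Hb by (try exact Hg; apply Hx).
  assert (1 < beta) by apply Hg.
  exact (Huniq _ _ (is_expansion_prepend beta x _ a H Hx Ha)
                   (is_expansion_prepend beta x _ b H Hx Hb) (S n)).
Qed.

Definition avoids_switch beta x := forall n, ~ switch beta (Nat.iter n (Gmap beta) x).

Lemma avoids_switch_Gmap beta x : avoids_switch beta x -> avoids_switch beta (Gmap beta x).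
Proof. intros H n. rewrite <- Nat.iter_succ_r. apply H. Qed.

(** For the converse, as long as the remainders of an expansion follow the greedy orbit they are
    outside the switch region, where only one digit keeps the next remainder in the domain; that
    digit is the greedy one. *)
Lemma Ubeta_iff beta x : above_golden beta ->
  Ubeta beta x <-> domain beta x /\ avoids_switch beta x.
Proof.
  intros Hg. split.
  - intros HU. split; [apply HU|].
    assert (H : forall n, Ubeta beta (Nat.iter n (Gmap beta) x)).
    { induction n as [|n IH]; simpl; [exact HU | apply Ubeta_Gmap; assumption]. }
    intros n. apply Ubeta_not_switch; [exact Hg | apply H].
  - intros [Hx Hav]. split; [exact Hx|].
    split; [exists (fun n => digit beta (Nat.iter n (Gmap beta) x));
            apply greedy_expansion; assumption|].
    destruct (above_golden_facts beta Hg) as (Hb & Hi & E1 & E2 & E3 & _).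
    assert (H : forall a, is_expansion beta x a -> forall n,
              a n = digit beta (Nat.iter n (Gmap beta) x)).
    { intros a Ha. rewrite is_expansion_iff in Ha by lra.
      assert (Hd : forall n, remainder beta (fun k => b2R (a k)) x n = Nat.iter n (Gmap beta) x ->
                 a n = digit beta (Nat.iter n (Gmap beta) x)).
      { intros n En. assert (HS := Ha (S n)). simpl in HS. rewrite En in HS.
        specialize (Hav n). unfold switch in Hav. set (z := Nat.iter n (Gmap beta) x) in *.
        destruct HS as [HS1 HS2]. unfold digit.
        destruct (Rlt_dec z (/ beta)) as [Hlt|Hge]; destruct (a n); try reflexivity;
          exfalso; simpl in *.
        - assert (beta * z < beta * / beta) by (apply mul_beta_lt; lra). lra.
        - apply Hav. split; [lra|]. rewrite E3. apply Rmult_le_reg_l with beta; lra. }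
      assert (En : forall n, remainder beta (fun k => b2R (a k)) x n = Nat.iter n (Gmap beta) x).
      { induction n as [|n IH]; [reflexivity|]. simpl.
        rewrite Gmap_digit; [|exact Hg | apply (orbit_domain beta x n Hg Hx)].
        rewrite <- (Hd n IH), IH. reflexivity. }
      intros n. apply Hd, En. }
    intros a b Ha Hb' n. rewrite (H a Ha), (H b Hb'). reflexivity.
Qed.

(** * The greedy orbits of 1 and of its mirror image *)

(** Meant for the difference of two bounded orbits driven by the same digits, which must coincide,
    and for one bounded orbit with zero digits, which must vanish. *)
Lemma bounded_expanding_zero beta (e : nat -> R) B :
  1 < beta -> (forall k, e (S k) = beta * e k) -> (forall k, Rabs (e k) <= B) -> e 0%nat = 0.
Proof.
  intros Hb He HB.
  assert (Hk : forall k, e k = e 0%nat * beta ^ k).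
  { induction k as [|k IH]; simpl; [ring | rewrite He, IH; ring]. }
  apply NNPP. intros Hne. assert (H0 : 0 < Rabs (e 0%nat)) by (apply Rabs_pos_lt, Hne).
  assert (HB0 : 0 < B) by (eapply Rlt_le_trans; [exact H0 | apply HB]).
  destruct (inv_pow_small beta (Rabs (e 0%nat) / B) Hb) as [N HN].
  { apply Rdiv_lt_0_compat; assumption. }
  specialize (HN N (le_n N)). specialize (HB N). rewrite Hk, Rabs_mult in HB.
  assert (Hp : 0 < beta ^ N) by (apply pow_lt; lra).
  rewrite (Rabs_pos_eq (beta ^ N)) in HB by lra.
  assert (H : / beta ^ N * (B * beta ^ N) < Rabs (e 0%nat) / B * (B * beta ^ N)).
  { apply Rmult_lt_compat_r; [apply Rmult_lt_0_compat; assumption | exact HN]. }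
  replace (/ beta ^ N * (B * beta ^ N)) with B in H by (field; lra).
  replace (Rabs (e 0%nat) / B * (B * beta ^ N)) with (Rabs (e 0%nat) * beta ^ N) in H
    by (field; lra).
  lra.
Qed.

Notation orbit1 beta n := (Nat.iter n (Gmap beta) 1).

Lemma orbit1_step beta n : above_golden beta ->
  0 <= orbit1 beta n <= 1 /\
  (gdigit beta n = 0%Z \/ gdigit beta n = 1%Z) /\
  orbit1 beta (S n) = beta * orbit1 beta n - IZR (gdigit beta n).
Proof.
  intros Hg. destruct (above_golden_facts beta Hg) as (Hb & Hi & E1 & _).
  assert (H01 : 0 <= orbit1 beta n <= 1).
  { destruct n as [|n]; [simpl; lra|]. simpl.
    assert (Hr : forall y, 0 <= y <= 1 -> 0 <= Gmap beta y <= 1).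
    { intros y Hy. unfold Gmap. destruct (Rlt_dec y 1).
      - destruct (base_fp (beta * y)). lra.
      - replace y with 1 by lra. lra. }
    induction n as [|n IH]; apply Hr; simpl; [lra | exact IH]. }
  split; [exact H01|]. set (y := orbit1 beta n) in *.
  assert (HG : gdigit beta n = if Rlt_dec y (/ beta) then 0%Z else 1%Z).
  { unfold gdigit. fold y. destruct (Rlt_dec y (/ beta)); apply Int_part_unique.
    - assert (beta * y < beta * / beta) by (apply mul_beta_lt; lra).
      assert (0 <= beta * y) by (apply Rmult_le_pos; lra). lra.
    - assert (beta * / beta <= beta * y) by (apply mul_beta_le; lra).
      assert (beta * y <= beta * 1) by (apply mul_beta_le; lra). lra. }
  split; [rewrite HG; destruct (Rlt_dec y (/ beta)); auto|].
  change (Gmap beta y = beta * y - IZR (gdigit beta n)).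
  rewrite HG, Gmap_digit by (try exact Hg; apply H01).
  unfold digit. destruct (Rlt_dec y (/ beta)); reflexivity.
Qed.

Lemma orbit1_abs beta n : above_golden beta -> Rabs (orbit1 beta n) <= 1.
Proof. intros Hg. destruct (orbit1_step beta n Hg) as [H _]. rewrite Rabs_pos_eq; lra. Qed.

(** Periodic digits make the difference between the orbit and its shift by [P] expand freely while
    staying bounded, so it is 0 from [N] on; subtracting [P] then brings any index below [N + P]. *)
Lemma orbit1_finite beta : above_golden beta -> greedy_eventually_periodic beta ->
  exists K, forall n, exists k, (k < K)%nat /\ orbit1 beta n = orbit1 beta k.
Proof.
  intros Hg (N & P & HP & Hper). exists (N + P)%nat.
  assert (Hrep : forall k, (N <= k)%nat -> orbit1 beta (k + P) = orbit1 beta k).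
  { intros k Hk.
    assert (H : orbit1 beta (k + 0 + P) - orbit1 beta (k + 0) = 0).
    { apply (bounded_expanding_zero beta
               (fun j => orbit1 beta (k + j + P) - orbit1 beta (k + j)) 2).
      - apply Hg.
      - intros j. replace (k + S j + P)%nat with (S (k + j + P)) by lia.
        replace (k + S j)%nat with (S (k + j)) by lia.
        destruct (orbit1_step beta (k + j + P) Hg) as (_ & _ & ->).
        destruct (orbit1_step beta (k + j) Hg) as (_ & _ & ->).
        rewrite Hper by lia. ring.
      - intros j. unfold Rminus. eapply Rle_trans; [apply Rabs_triang|]. rewrite Rabs_Ropp.
        assert (H1 := orbit1_abs beta (k + j + P) Hg).
        assert (H2 := orbit1_abs beta (k + j) Hg). lra. }
    rewrite Nat.add_0_r in H. apply Rminus_diag_uniq. exact H. }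
  intros n. induction n as [n IH] using (well_founded_induction lt_wf).
  destruct (Nat.lt_ge_cases n (N + P)) as [Hlt|Hge]; [exists n; auto|].
  destruct (IH (n - P)%nat) as (k & Hk & E); [lia|].
  exists k. split; [exact Hk|]. rewrite <- E, <- (Hrep (n - P)%nat) by lia.
  replace (n - P + P)%nat with n by lia. reflexivity.
Qed.

Lemma mod_succ_step k m : (k mod S m <> m -> (S k) mod S m = S (k mod S m)) /\
  (k mod S m = m -> (S k) mod S m = 0)%nat.
Proof.
  assert (H1 := Nat.div_mod_eq k (S m)). assert (H2 := Nat.mod_upper_bound k (S m) ltac:(lia)).
  split; intros H.
  - symmetry. apply (Nat.mod_unique _ _ (k / S m)); lia.
  - symmetry. apply (Nat.mod_unique _ _ (S (k / S m))); [lia|].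
    rewrite Nat.mul_succ_r. lia.
Qed.

(* The quasi-greedy orbit only differs from the greedy one after the latter has hit [/ beta],
   from which the quasi-greedy orbit returns to [1]. *)
Lemma orbit1_avoids beta n : above_golden beta -> quasi_greedy_orbit_avoids beta ->
  ~ (/ beta < orbit1 beta n <= / beta * / (beta - 1)).
Proof.
  intros Hg Hq. destruct (above_golden_facts beta Hg) as (Hb & Hi & E1 & E2 & E3 & HL & _).
  (* The hypothesis starts at index 1. For index 0, the point 1 is beyond the switch region because
     [beta] is above the golden ratio. *)
  destruct n as [|n']; [simpl; lra|]. set (n := S n').
  destruct (classic (forall m, exists k, (m < k)%nat /\ gdigit beta k <> 0%Z)) as [Hinf|Hfin].
  - apply (Hq (gdigit beta)) with (i := n); [left; auto | lia |].
    assert (H : infinite_sum (fun j => IZR (gdigit beta (n + j)) / beta ^ S j)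
                  (orbit1 beta (n + 0))).
    { apply (infinite_sum_of_bounded_orbit beta (fun j => IZR (gdigit beta (n + j)))
               (fun j => orbit1 beta (n + j)) 1); [lra | intros; apply orbit1_abs, Hg |].
      intros j. replace (n + S j)%nat with (S (n + j)) by lia. apply orbit1_step, Hg. }
    rewrite Nat.add_0_r in H. exact H.
  - assert (Hlast : exists m, gdigit beta m = 1%Z /\ forall k, (m < k)%nat -> gdigit beta k = 0%Z).
    { assert (Hex : exists m0, forall k, (m0 < k)%nat -> gdigit beta k = 0%Z).
      { apply NNPP. intros Hc. apply Hfin. intros m. apply NNPP. intros Hc'. apply Hc.
        exists m. intros k Hk. apply NNPP. intros Hne. apply Hc'. exists k. auto. }
      destruct Hex as [m0 Hm0].
      induction m0 as [|m0 IH].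
      - exists 0%nat. split; [|exact Hm0]. unfold gdigit. apply Int_part_unique. simpl. lra.
      - destruct (orbit1_step beta (S m0) Hg) as (_ & [Hz|Ho] & _).
        + apply IH. intros k Hk.
          destruct (Nat.eq_dec k (S m0)) as [->|]; [exact Hz | apply Hm0; lia].
        + exists (S m0). auto. }
    destruct Hlast as (m & Hm1 & Hm0).
    assert (Hzero : forall k, (m < k)%nat -> orbit1 beta k = 0).
    { intros k Hk. rewrite <- (Nat.add_0_r k).
      apply (bounded_expanding_zero beta (fun j => orbit1 beta (k + j)) 1); [lra | |].
      - intros j. replace (k + S j)%nat with (S (k + j)) by lia.
        destruct (orbit1_step beta (k + j) Hg) as (_ & _ & ->). rewrite Hm0 by lia. ring.
      - intros j. apply orbit1_abs, Hg. }
    destruct (Nat.lt_ge_cases m n) as [Hlt|Hge]; [rewrite Hzero by exact Hlt; lra|].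
    set (eta := fun k => if Nat.eqb (k mod (S m)) m then 0%Z else gdigit beta (k mod (S m))).
    apply (Hq eta) with (i := n); [right; exists m; repeat split; auto | lia |].
    assert (H : infinite_sum (fun j => IZR (eta (n + j)%nat) / beta ^ S j)
                  (orbit1 beta ((n + 0) mod (S m)))).
    { apply (infinite_sum_of_bounded_orbit beta (fun j => IZR (eta (n + j)%nat))
               (fun j => orbit1 beta ((n + j) mod (S m))) 1);
        [lra | intros; apply orbit1_abs, Hg |].
      intros j. replace (n + S j)%nat with (S (n + j)) by lia.
      destruct (mod_succ_step (n + j) m) as [Hs1 Hs2]. unfold eta.
      destruct (Nat.eqb_spec ((n + j) mod S m) m) as [Heq|Hne].
      (* The orbit reaches 0 with digit 1 at index [m], so its value there is [/ beta]; the replaced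
         digit 0 sends it to 1, the start of the cycle. *)
      - rewrite Hs2 by exact Heq. rewrite Heq.
        destruct (orbit1_step beta m Hg) as (_ & _ & Hstep).
        rewrite Hm1, Hzero in Hstep by lia. simpl (orbit1 beta 0). lra.
      - rewrite Hs1 by exact Hne. apply orbit1_step, Hg. }
    rewrite Nat.add_0_r, Nat.mod_small in H by lia. exact H.
Qed.

(** [bar1] is [L - 1] with [L = / (beta - 1)], and [x |-> L - x] exchanges the two branches off the
    switch region. The orbit of 1 can meet that region only at [/ beta], whose mirror image
    [L - / beta] is mapped back to [L - 1]; hence [k] may restart from 0 and need not equal [n]. *)
Lemma bar1_orbit beta n : above_golden beta -> quasi_greedy_orbit_avoids beta ->
  exists k, Nat.iter n (Gmap beta) (bar1 beta) = / (beta - 1) - orbit1 beta k.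
Proof.
  intros Hg Hq. destruct (above_golden_facts beta Hg) as (Hb & Hi & E1 & E2 & E3 & HL & H2i).
  induction n as [|n [k IH]].
  - exists 0%nat. simpl. unfold bar1. field. lra.
  - simpl. rewrite IH.
    assert (Hav := orbit1_avoids beta k Hg Hq).
    destruct (orbit1_step beta k Hg) as [H01 _]. set (y := orbit1 beta k) in *.
    destruct (Rtotal_order y (/ beta)) as [Hlt|[Heq|Hgt]].
    + exists (S k). simpl. fold y. rewrite Gmap_high by (auto; lra).
      rewrite Gmap_low by (auto; lra). lra.
    + exists 0%nat. rewrite Gmap_high by (auto; lra). simpl.
      rewrite Heq. lra.
    + exists (S k). simpl. fold y. rewrite Gmap_low by (auto; lra).
      rewrite Gmap_high by (auto; lra). lra.
Qed.

(** It is enough to know some list containing all partition points: membership in the set is not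
    decidable and is filtered classically during insertion. *)
Lemma sorted_enumeration (P : R -> Prop) (l : list R) :
  exists l', StronglySorted Rlt l' /\ forall x, In x l' <-> In x l /\ P x.
Proof.
  assert (Hins : forall a l', StronglySorted Rlt l' ->
            exists l'', StronglySorted Rlt l'' /\ forall x, In x l'' <-> x = a \/ In x l').
  { intros a l' Hs. induction Hs as [|b l' Hs IH Hall].
    - exists (a :: nil). split; [repeat constructor|]. intros x. simpl. intuition.
    - destruct (Rtotal_order a b) as [Hlt|[->|Hgt]].
      + exists (a :: b :: l'). split.
        * constructor; [constructor; assumption|]. constructor; [exact Hlt|].
          eapply Forall_impl; [|exact Hall]. simpl. intros. lra.
        * intros x. simpl. intuition.
      + exists (b :: l'). split; [constructor; assumption|]. intros x. simpl. intuition.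
      + destruct IH as (l'' & Hs'' & Hin). exists (b :: l''). split.
        * constructor; [exact Hs''|]. apply Forall_forall. intros x Hx.
          apply Hin in Hx. destruct Hx as [->|Hx]; [exact Hgt|].
          rewrite Forall_forall in Hall. apply Hall, Hx.
        * intros x. simpl. rewrite Hin. intuition. }
  induction l as [|a l (l' & Hs & Hin)].
  - exists nil. split; [constructor|]. simpl. intuition.
  - destruct (classic (P a)) as [Ha|Ha].
    + destruct (Hins a l' Hs) as (l'' & Hs'' & Hin''). exists l''. split; [exact Hs''|].
      intros x. rewrite Hin'', Hin. simpl. intuition; subst; auto.
    + exists l'. split; [exact Hs|]. intros x. rewrite Hin. simpl. intuition.
      subst. contradiction.
Qed.

Lemma StronglySorted_nth l : StronglySorted Rlt l ->
  forall i, (S i < length l)%nat -> nth i l 0 < nth (S i) l 0.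
Proof.
  intros Hs. induction Hs as [|a l Hs IH Hall]; intros i Hi; simpl in Hi; [lia|].
  destruct i as [|i].
  - rewrite Forall_forall in Hall. apply Hall. simpl. apply nth_In. lia.
  - apply IH. lia.
Qed.

Lemma enumC_exists beta : above_golden beta -> greedy_eventually_periodic beta ->
  quasi_greedy_orbit_avoids beta -> exists p c, enumC beta p c.
Proof.
  intros Hg Hper Hq. destruct (orbit1_finite beta Hg Hper) as [K HK].
  set (l1 := map (fun k => orbit1 beta k) (seq 0 K)).
  assert (Hl1 : forall n, In (orbit1 beta n) l1).
  { intros n. destruct (HK n) as (k & Hk & ->). apply (in_map (fun k => orbit1 beta k)).
    apply in_seq. lia. }
  set (l := l1 ++ map (fun y => / (beta - 1) - y) l1 ++
            0 :: / beta :: / beta * / (beta - 1) :: 1 :: / (beta - 1) :: nil).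
  assert (HC : forall x, inC beta x -> In x l).
  { intros x Hx. unfold l. rewrite !in_app_iff.
    destruct Hx as [[n ->]|[[n ->]|Hx]].
    - left. apply Hl1.
    - right. left. destruct (bar1_orbit beta n Hg Hq) as [k ->].
      apply (in_map (fun y => / (beta - 1) - y)), Hl1.
    - right. right. simpl. intuition. }
  destruct (sorted_enumeration (inC beta) l) as (l' & Hs & Hin).
  exists (length l'), (fun i => nth (i - 1) l' 0). split; [|split].
  - intros i Hi. replace (S i - 1)%nat with (S (i - 1)) by lia.
    apply StronglySorted_nth; [exact Hs | lia].
  - intros i Hi. apply Hin. apply nth_In. lia.
  - intros x Hx. assert (Hx' : In x l') by (apply Hin; auto).
    destruct (In_nth l' x 0 Hx') as (j & Hj & Ej).
    exists (S j). split; [lia|]. simpl. rewrite Nat.sub_0_r. exact Ej.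
Qed.

Lemma inC_domain beta x : above_golden beta -> inC beta x -> domain beta x.
Proof.
  intros Hg Hx. destruct (above_golden_facts beta Hg) as (Hb & Hi & E1 & E2 & E3 & HL & H2i).
  destruct Hx as [[n ->]|[[n ->]|Hx]].
  - apply orbit_domain; [exact Hg|]. unfold domain. lra.
  - apply orbit_domain; [exact Hg|]. unfold domain.
    replace (bar1 beta) with (/ (beta - 1) - 1) by (unfold bar1; field; lra). lra.
  - unfold domain. rewrite E3 in Hx. lra.
Qed.

(** This invariance is the source of the Markov property. The only case that uses the choice of
    [bar1] is the right end of the switch region, which is sent there. *)
Lemma inC_Gmap beta x : above_golden beta -> inC beta x -> inC beta (Gmap beta x).
Proof.
  intros Hg Hx. destruct (above_golden_facts beta Hg) as (Hb & Hi & E1 & E2 & E3 & HL & H2i).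
  destruct Hx as [[n ->]|[[n ->]|[->|[->|[->|[->| ->]]]]]].
  - left. exists (S n). reflexivity.
  - right. left. exists (S n). reflexivity.
  - rewrite Gmap_low by (auto; lra). right. right. left. ring.
  - rewrite Gmap_high by (auto; lra). right. right. left. lra.
  - rewrite Gmap_high by (auto; lra). right. left. exists 0%nat. simpl. unfold bar1. field. lra.
  - left. exists 1%nat. reflexivity.
  - rewrite Gmap_high by (auto; lra). right. right. right. right. right. right. lra.
Qed.

(** Hence the switch region is not subdivided. Its symmetry under [x |-> / (beta - 1) - x] carries
    the statement from the orbit of 1 to that of [bar1]. *)
Lemma inC_not_in_switch beta x : above_golden beta -> quasi_greedy_orbit_avoids beta ->
  inC beta x -> ~ (/ beta < x < / beta * / (beta - 1)).
Proof.
  intros Hg Hq Hx.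
  destruct (above_golden_facts beta Hg) as (Hb & Hi & E1 & E2 & E3 & HL & H2i).
  destruct Hx as [[n ->]|[[n ->]|Hx]].
  - assert (H := orbit1_avoids beta n Hg Hq). lra.
  - destruct (bar1_orbit beta n Hg Hq) as [k ->]. assert (H := orbit1_avoids beta k Hg Hq). lra.
  - rewrite E3 in *. lra.
Qed.

(** * The Markov partition *)

(* On [A_i] the map [T^(i)] is [x |-> beta * x - t i], with image [[c (k i), c (k' i)]]. *)
Record markov_partition beta p (c : nat -> R) i0 (k k' : nat -> nat) (t : nat -> R) : Prop := {
  mp_golden : above_golden beta;
  mp_i0 : (2 <= i0)%nat /\ (S i0 < p)%nat;
  mp_incr : forall i j, (1 <= i < j)%nat -> (j <= p)%nat -> c i < c j;
  mp_first : c 1%nat = 0;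
  mp_last : c p = / (beta - 1);
  mp_switch_left : c i0 = / beta;
  mp_switch_right : c (S i0) = / beta * / (beta - 1);
  mp_image : forall i, (1 <= i < p)%nat -> i <> i0 ->
    (1 <= k i < k' i)%nat /\ (k' i <= p)%nat /\
    c (k i) = beta * c i - t i /\ c (k' i) = beta * c (S i) - t i;
  mp_k1 : k 1%nat = 1%nat;
  mp_map : forall i x, (1 <= i < p)%nat -> inA c i x -> ~ switch beta x ->
    Gmap beta x = beta * x - t i;
  mp_smat : forall i j, (1 <= i < p)%nat -> i <> i0 -> (1 <= j < p)%nat ->
    Smat beta c i j = if andb (Nat.leb (k i) j) (Nat.ltb j (k' i)) then 1 else 0
}.

Lemma increasing_mono p (c : nat -> R) :
  (forall i, (1 <= i < p)%nat -> c i < c (S i)) ->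
  forall i j, (1 <= i < j)%nat -> (j <= p)%nat -> c i < c j.
Proof.
  intros H i j Hij Hj. induction j as [|j IH]; [lia|].
  assert (c j < c (S j)) by (apply H; lia).
  destruct (Nat.eq_dec i j) as [->|]; [assumption|].
  apply Rlt_trans with (c j); [apply IH; lia | assumption].
Qed.

Lemma index_lt_of_value_lt p (c : nat -> R) :
  (forall i j, (1 <= i < j)%nat -> (j <= p)%nat -> c i < c j) ->
  forall i j, (1 <= j <= p)%nat -> (1 <= i <= p)%nat -> c i < c j -> (i < j)%nat.
Proof.
  intros H i j Hj Hi Hlt. destruct (Nat.lt_trichotomy i j) as [?|[->|Hgt]]; [assumption|lra|].
  assert (c j < c i) by (apply H; lia). lra.
Qed.

Lemma partition_covers (c : nat -> R) a b x :
  (a < b)%nat -> c a <= x <= c b -> exists i, (a <= i < b)%nat /\ inA c i x.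
Proof.
  intros Hab. induction Hab as [|b Hab IH]; intros Hx.
  - exists a. split; [lia | exact Hx].
  - destruct (Rle_dec x (c b)).
    + destruct IH as (i & Hi & HA); [lra|]. exists i. split; [lia | exact HA].
    + exists b. split; [lia|]. unfold inA. lra.
Qed.

(** Each branch is affine and increasing, so the image of a cell is the segment between the images
    of its ends, which are again partition points. A row of [S] other than [i0] is thus the
    indicator of the index range from [k i] to [k' i - 1]. *)
Lemma markov_partition_exists beta : above_golden beta -> greedy_eventually_periodic beta ->
  quasi_greedy_orbit_avoids beta ->
  exists p c i0 k k' t, enumC beta p c /\ markov_partition beta p c i0 k k' t.
Proof.
  intros Hg Hper Hq.
  destruct (enumC_exists beta Hg Hper Hq) as (p & c & Hc). exists p, c.
  destruct (above_golden_facts beta Hg) as (Hb & Hi & E1 & E2 & E3 & HL & H2i).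
  assert (HC := Hc). destruct HC as (Hinc & HinC & Hsurj).
  assert (Hmono := increasing_mono p c Hinc).
  assert (Hidx := index_lt_of_value_lt p c Hmono).
  assert (HCb : inC beta (/ beta)) by (right; right; right; left; reflexivity).
  assert (HCs : inC beta (/ beta * / (beta - 1))) by (right; right; right; right; left; reflexivity).
  assert (HC0 : inC beta 0) by (right; right; left; reflexivity).
  assert (HCL : inC beta (/ (beta - 1))) by (right; right; right; right; right; right; reflexivity).
  destruct (Hsurj _ HCb) as (i0 & Hi0 & Ei0). destruct (Hsurj _ HCs) as (i1 & Hi1 & Ei1).
  destruct (Hsurj _ HC0) as (iz & Hiz & Eiz). destruct (Hsurj _ HCL) as (il & Hil & Eil).
  assert (iz = 1%nat) as ->.
  { destruct (Nat.eq_dec iz 1) as [|Hne]; [assumption|exfalso].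
    assert (c 1%nat < c iz) by (apply Hmono; lia).
    destruct (inC_domain beta (c 1%nat) Hg (HinC 1%nat ltac:(lia))). lra. }
  assert (il = p) as ->.
  { destruct (Nat.eq_dec il p) as [|Hne]; [assumption|exfalso].
    assert (c il < c p) by (apply Hmono; lia).
    destruct (inC_domain beta (c p) Hg (HinC p ltac:(lia))). lra. }
  assert (H1i0 : (1 < i0)%nat) by (apply Hidx; try lia; lra).
  assert (H01 : (i0 < i1)%nat) by (apply Hidx; try lia; lra).
  assert (H1p : (i1 < p)%nat) by (apply Hidx; try lia; lra).
  assert (i1 = S i0) as ->.
  { destruct (Nat.eq_dec i1 (S i0)) as [|Hne]; [assumption|exfalso].
    apply (inC_not_in_switch beta (c (S i0)) Hg Hq); [apply HinC; lia|].
    rewrite <- Ei1, <- Ei0. split; apply Hmono; lia. }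
  set (t := fun i => if Nat.ltb i i0 then 0 else 1).
  assert (Hlow : forall i x, (1 <= i < p)%nat -> (i < i0)%nat -> inA c i x ->
                  0 <= x <= / beta).
  { intros i x Hip Hlt [Hx1 Hx2].
    destruct (inC_domain beta (c i) Hg (HinC i ltac:(lia))).
    assert (c (S i) <= c i0).
    { destruct (Nat.eq_dec (S i) i0) as [->|]; [lra | left; apply Hmono; lia]. } lra. }
  assert (Hhigh : forall i x, (1 <= i < p)%nat -> (i0 < i)%nat -> inA c i x ->
                  / beta <= x <= / (beta - 1)).
  { intros i x Hip Hlt [Hx1 Hx2].
    destruct (inC_domain beta (c (S i)) Hg (HinC (S i) ltac:(lia))).
    assert (c i0 < c i) by (apply Hmono; lia). lra. }
  assert (HinA : forall i, (1 <= i < p)%nat -> inA c i (c i) /\ inA c i (c (S i))).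
  { intros i Hip. specialize (Hinc i Hip). unfold inA. lra. }
  assert (Himg : forall i x, (1 <= i < p)%nat -> i <> i0 -> inA c i x -> inC beta x ->
                  inC beta (beta * x - t i)).
  { intros i x Hip Hne HA Hx. unfold t. destruct (Nat.ltb_spec i i0) as [Hlt|Hge].
    - destruct (Hlow i x Hip Hlt HA) as [H1 [H2|H2]].
      + replace (beta * x - 0) with (Gmap beta x); [apply inC_Gmap; assumption|].
        rewrite Gmap_low by auto. ring.
      (* The right end [/ beta] of the cell next to the switch region: its image under this branch
         is 1, whereas [Gmap] sends it to 0. *)
      + right. right. right. right. right. left. rewrite H2. lra.
    - destruct (Hhigh i x Hip ltac:(lia) HA) as [H1 H2].
      rewrite <- Gmap_high by auto. apply inC_Gmap; assumption. }
  destruct (ClassicalEpsilon.choice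
    (fun i j => (1 <= i < p)%nat -> i <> i0 -> (1 <= j <= p)%nat /\ c j = beta * c i - t i))
    as [k Hk].
  { intros i. destruct (classic ((1 <= i < p)%nat /\ i <> i0)) as [[Hip Hne]|Hn].
    - destruct (Hsurj (beta * c i - t i)) as (j & Hj & Ej).
      + apply Himg; [exact Hip | exact Hne | apply HinA, Hip | apply HinC; lia].
      + exists j. auto.
    - exists 0%nat. intros H1 H2. exfalso. auto. }
  destruct (ClassicalEpsilon.choice
    (fun i j => (1 <= i < p)%nat -> i <> i0 -> (1 <= j <= p)%nat /\ c j = beta * c (S i) - t i))
    as [k' Hk'].
  { intros i. destruct (classic ((1 <= i < p)%nat /\ i <> i0)) as [[Hip Hne]|Hn].
    - destruct (Hsurj (beta * c (S i) - t i)) as (j & Hj & Ej).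
      + apply Himg; [exact Hip | exact Hne | apply HinA, Hip | apply HinC; lia].
      + exists j. auto.
    - exists 0%nat. intros H1 H2. exfalso. auto. }
  assert (Hkk : forall i, (1 <= i < p)%nat -> i <> i0 -> (k i < k' i)%nat).
  { intros i Hip Hne. destruct (Hk i Hip Hne) as [Hr E]. destruct (Hk' i Hip Hne) as [Hr' E'].
    apply Hidx; [exact Hr' | exact Hr |]. rewrite E, E'.
    assert (beta * c i < beta * c (S i)) by (apply mul_beta_lt; [lra | apply Hinc, Hip]). lra. }
  assert (HT : forall i, (1 <= i < p)%nat -> i <> i0 ->
                 forall x, Tmap beta c i x = beta * x - t i).
  { intros i Hip Hne x. unfold Tmap, t. destruct (excluded_middle_informative _) as [Hy|Hy];
      destruct (Nat.ltb_spec i i0) as [Hlt|Hge]; try ring; exfalso.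
    - assert (c i < c i0) by (apply Hmono; lia).
      destruct (Hy (c i)); [apply HinA, Hip|]. lra.
    - apply Hy. intros y HA. apply (Hhigh i y Hip); [lia | exact HA]. }
  exists i0, k, k', t. split; [exact Hc|]. constructor; try assumption; try lia.
  - intros i Hip Hne. destruct (Hk i Hip Hne) as [Hr E]. destruct (Hk' i Hip Hne) as [Hr' E'].
    specialize (Hkk i Hip Hne). repeat split; try lia; assumption.
  - destruct (Hk 1%nat) as [Hr E]; [lia|lia|].
    unfold t in E. rewrite (proj2 (Nat.ltb_lt 1 i0) H1i0), Eiz in E.
    destruct (Nat.eq_dec (k 1%nat) 1) as [|Hne]; [assumption|exfalso].
    assert (c 1%nat < c (k 1%nat)) by (apply Hmono; lia). lra.
  - intros i x Hip HA Hns. unfold t. destruct (Nat.ltb_spec i i0) as [Hlt|Hge].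
    + destruct (Hlow i x Hip Hlt HA) as [H1 [H2|H2]].
      * rewrite Gmap_low by auto. ring.
      * exfalso. apply Hns. unfold switch. lra.
    + destruct (Nat.eq_dec i i0) as [->|Hne].
      * exfalso. apply Hns. unfold switch. rewrite <- Ei1, <- Ei0. exact HA.
      * apply Gmap_high; [exact Hg|]. apply (Hhigh i x Hip); [lia | exact HA].
  - intros i j Hip Hne Hj. destruct (Hk i Hip Hne) as [Hr E]. destruct (Hk' i Hip Hne) as [Hr' E'].
    assert (Hle : forall a b, (1 <= a <= p)%nat -> (1 <= b <= p)%nat -> (a <= b)%nat -> c a <= c b).
    { intros a b Ha Hb' Hab. destruct (Nat.eq_dec a b) as [->|]; [lra | left; apply Hmono; lia]. }
    unfold Smat. destruct (excluded_middle_informative _) as [Hsub|Hsub];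
      destruct (Nat.leb_spec (k i) j) as [H1|H1]; destruct (Nat.ltb_spec j (k' i)) as [H2|H2];
      simpl; try reflexivity; exfalso.
    + destruct (Hsub (c (S j))) as (y & HA & Ey); [apply HinA, Hj|].
      rewrite HT in Ey by assumption. destruct HA as [HA1 HA2].
      assert (beta * y <= beta * c (S i)) by (apply mul_beta_le; lra).
      assert (c (k' i) < c (S j)) by (apply Hmono; lia). lra.
    + destruct (Hsub (c j)) as (y & HA & Ey); [apply HinA, Hj|].
      rewrite HT in Ey by assumption. destruct HA as [HA1 HA2].
      assert (beta * c i <= beta * y) by (apply mul_beta_le; lra).
      assert (c j < c (k i)) by (apply Hmono; lia). lra.
    + specialize (Hkk i Hip Hne). lia.
    + apply Hsub. intros x [Hx1 Hx2]. exists ((x + t i) * / beta).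
      rewrite HT by assumption. split; [|field; lra].
      assert (c (k i) <= c j) by (apply Hle; lia).
      assert (c (S j) <= c (k' i)) by (apply Hle; lia).
      split; apply Rmult_le_reg_l with beta; try lra;
        replace (beta * ((x + t i) * / beta)) with (x + t i) by (field; lra); lra.
Qed.

Lemma Sprime_nonneg beta c i0 k l : 0 <= Sprime beta c i0 k l.
Proof. unfold Sprime, Smat. destruct (excluded_middle_informative _); lra. Qed.

Lemma rsum_sidx i0 n f : (1 <= i0 <= S n)%nat ->
  rsum n (fun k => f (sidx i0 k)) + f i0 = rsum (S n) (fun j => f (S j)).
Proof.
  intros Hi0. induction n as [|n IH].
  - simpl. replace i0 with 1%nat by lia. reflexivity.
  - destruct (Nat.eq_dec i0 (S (S n))) as [->|Hne].
    + rewrite (rsum_ext (S n) _ (fun j => f (S j))); [reflexivity|].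
      intros k Hk. unfold sidx. rewrite (proj2 (Nat.ltb_lt _ _)) by lia. reflexivity.
    + change (rsum n (fun k => f (sidx i0 k)) + f (sidx i0 n) + f i0
              = rsum (S n) (fun j => f (S j)) + f (S (S n))).
      rewrite <- IH by lia. unfold sidx at 2.
      rewrite (proj2 (Nat.ltb_ge _ _)) by lia. ring.
Qed.

Lemma sidx_range i0 p k : (k < p - 2)%nat -> (1 <= sidx i0 k < p)%nat /\ sidx i0 k <> i0.
Proof. intros Hk. unfold sidx. destruct (Nat.ltb_spec (S k) i0); lia. Qed.

Lemma sidx_surj i0 p j : (1 <= j < p)%nat -> (1 <= i0 < p)%nat -> j <> i0 ->
  exists k, (k < p - 2)%nat /\ sidx i0 k = j.
Proof.
  intros Hj Hi0 Hne. destruct (Nat.lt_ge_cases j i0) as [Hlt|Hge].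
  - exists (j - 1)%nat. unfold sidx. destruct (Nat.ltb_spec (S (j - 1)) i0); lia.
  - exists (j - 2)%nat. unfold sidx. destruct (Nat.ltb_spec (S (j - 2)) i0); lia.
Qed.

(** * Upper bound *)

(** The number of intervals is compared with a real because the bounds have the form
    [u q * rho ^ m]. *)
Definition coverable (E : R -> Prop) d B :=
  exists l : list R, INR (length l) <= B /\ forall x, E x -> exists a, In a l /\ a <= x <= a + d.

Lemma coverable_union n (E : nat -> R -> Prop) d B :
  (forall l, (l < n)%nat -> coverable (E l) d (B l)) ->
  coverable (fun x => exists l, (l < n)%nat /\ E l x) d (rsum n B).
Proof.
  induction n as [|n IH]; intros H.
  - exists nil. split; [simpl; lra|]. intros x (l & Hl & _). lia.
  - destruct IH as (l1 & Hl1 & Hc1); [intros; apply H; lia|].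
    destruct (H n ltac:(lia)) as (l2 & Hl2 & Hc2).
    exists (l1 ++ l2). split; [rewrite length_app, plus_INR; simpl; lra|].
    intros x (l & Hl & Hx). destruct (Nat.eq_dec l n) as [->|Hne].
    + destruct (Hc2 x Hx) as (a & Ha & Hax). exists a. rewrite in_app_iff. auto.
    + destruct (Hc1 x) as (a & Ha & Hax); [exists l; split; [lia | exact Hx]|].
      exists a. rewrite in_app_iff. auto.
Qed.

Lemma coverable_preimage (E : R -> Prop) beta t d B : 0 < beta ->
  coverable E (beta * d) B -> coverable (fun x => E (beta * x - t)) d B.
Proof.
  intros Hb (l & Hl & Hc). exists (map (fun a => (a + t) / beta) l).
  split; [rewrite length_map; exact Hl|]. intros x Hx.
  destruct (Hc _ Hx) as (a & Ha & Hax). exists ((a + t) / beta).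
  split; [apply (in_map (fun a => (a + t) / beta)), Ha|].
  assert (E1 : beta * ((a + t) / beta) = a + t) by (field; lra).
  split; apply Rmult_le_reg_l with beta; lra.
Qed.

Lemma coverable_subset (E E' : R -> Prop) d B B' :
  (forall x, E x -> E' x) -> B' <= B -> coverable E' d B' -> coverable E d B.
Proof.
  intros HE HB (l & Hl & Hc). exists l. split; [lra|]. intros x Hx. apply Hc, HE, Hx.
Qed.

Lemma inA_domain beta p c i0 k k' t i x : markov_partition beta p c i0 k k' t ->
  (1 <= i < p)%nat -> inA c i x -> domain beta x.
Proof.
  intros Hm Hi [H1 H2].
  assert (0 <= c i).
  { rewrite <- (mp_first _ _ _ _ _ _ _ Hm). destruct (Nat.eq_dec i 1) as [->|]; [lra|].
    left. apply (mp_incr _ _ _ _ _ _ _ Hm); lia. }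
  assert (c (S i) <= / (beta - 1)).
  { rewrite <- (mp_last _ _ _ _ _ _ _ Hm). destruct (Nat.eq_dec (S i) p) as [->|]; [lra|].
    left. apply (mp_incr _ _ _ _ _ _ _ Hm); lia. }
  unfold domain. lra.
Qed.

Lemma domain_inA beta p c i0 k k' t x : markov_partition beta p c i0 k k' t ->
  domain beta x -> exists i, (1 <= i < p)%nat /\ inA c i x.
Proof.
  intros Hm Hx. apply partition_covers; [destruct (mp_i0 _ _ _ _ _ _ _ Hm); lia|].
  rewrite (mp_first _ _ _ _ _ _ _ Hm), (mp_last _ _ _ _ _ _ _ Hm). exact Hx.
Qed.

Lemma inA_switch beta p c i0 k k' t x : markov_partition beta p c i0 k k' t ->
  inA c i0 x <-> switch beta x.
Proof.
  intros Hm. unfold inA, switch.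
  rewrite (mp_switch_left _ _ _ _ _ _ _ Hm), (mp_switch_right _ _ _ _ _ _ _ Hm). tauto.
Qed.

Lemma image_inA beta p c i0 k k' t i x : markov_partition beta p c i0 k k' t ->
  (1 <= i < p)%nat -> i <> i0 -> inA c i x ->
  exists j, (k i <= j < k' i)%nat /\ inA c j (beta * x - t i).
Proof.
  intros Hm Hi Hne [H1 H2].
  destruct (mp_image _ _ _ _ _ _ _ Hm i Hi Hne) as (Hk & Hk' & E & E').
  destruct (mp_golden _ _ _ _ _ _ _ Hm) as [Hb _].
  apply partition_covers; [lia|]. rewrite E, E'.
  assert (beta * c i <= beta * x) by (apply mul_beta_le; lra).
  assert (beta * x <= beta * c (S i)) by (apply mul_beta_le; lra). lra.
Qed.

(** One more step splits a cylinder family over [A_i] into preimages, under one expanding branch, of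
    the families over the cells [A_l] with entry 1 in row [q]; the supersolution inequality is
    exactly what sums their counts. The deleted cell never occurs since the orbit avoids the switch
    region. *)
Lemma cylinders_cover beta p c i0 k k' t rho u m q :
  markov_partition beta p c i0 k k' t -> 0 <= rho ->
  supersolution (p - 2) (Sprime beta c i0) rho u -> (q < p - 2)%nat ->
  coverable (fun x => inA c (sidx i0 q) x /\ avoids_switch beta x)
            (/ (beta - 1) / beta ^ m) (u q * rho ^ m).
Proof.
  intros Hm Hrho Hu. revert q.
  assert (Hb : 1 < beta) by apply (mp_golden _ _ _ _ _ _ _ Hm).
  induction m as [|m IH]; intros q Hq; destruct (sidx_range i0 p q Hq) as [Hi Hne];
    set (i := sidx i0 q) in *.
  - exists (c i :: nil). split; [destruct (Hu q Hq); simpl; lra|].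
    intros x [HA _]. exists (c i). split; [left; reflexivity|].
    destruct (inA_domain _ _ _ _ _ _ _ _ _ Hm Hi HA) as [_ HxL].
    assert (HAc : inA c i (c i)) by (unfold inA in *; lra).
    destruct (inA_domain _ _ _ _ _ _ _ _ _ Hm Hi HAc). unfold inA in HA. simpl. lra.
  - apply (coverable_subset _
      (fun x => exists l, (l < p - 2)%nat /\
         (Sprime beta c i0 q l = 1 /\
          (inA c (sidx i0 l) (beta * x - t i) /\ avoids_switch beta (beta * x - t i)))) _ _
      (rsum (p - 2) (fun l => Sprime beta c i0 q l * (u l * rho ^ m)))).
    + intros x [HA Hav].
      assert (HG : Gmap beta x = beta * x - t i).
      { apply (mp_map _ _ _ _ _ _ _ Hm i x Hi HA). exact (Hav 0%nat). }
      assert (HavG := avoids_switch_Gmap beta x Hav). rewrite HG in HavG.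
      destruct (image_inA _ _ _ _ _ _ _ _ _ Hm Hi Hne HA) as (j & Hj & HAj).
      destruct (mp_image _ _ _ _ _ _ _ Hm i Hi Hne) as (Hk & Hk' & _ & _).
      assert (Hji : j <> i0).
      { intros ->. apply (HavG 0%nat). apply (inA_switch _ _ _ _ _ _ _ _ Hm), HAj. }
      destruct (sidx_surj i0 p j) as (l & Hl & El);
        [lia | destruct (mp_i0 _ _ _ _ _ _ _ Hm); lia | exact Hji |].
      exists l. split; [exact Hl|]. rewrite El. split; [|auto].
      unfold Sprime. fold i. rewrite El, (mp_smat _ _ _ _ _ _ _ Hm) by (assumption || lia).
      rewrite (proj2 (Nat.leb_le _ _)), (proj2 (Nat.ltb_lt _ _)) by lia. reflexivity.
    + rewrite (rsum_ext _ _ (fun l => rho ^ m * (Sprime beta c i0 q l * u l)))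
        by (intros; ring).
      rewrite rsum_scal. simpl.
      replace (u q * (rho * rho ^ m)) with (rho ^ m * (rho * u q)) by ring.
      apply Rmult_le_compat_l; [apply pow_le, Hrho | apply Hu, Hq].
    + apply coverable_union. intros l Hl.
      assert (H01 : Sprime beta c i0 q l = 1 \/ Sprime beta c i0 q l = 0).
      { unfold Sprime, Smat. destruct (excluded_middle_informative _); auto. }
      destruct H01 as [E|E]; rewrite E.
      * eapply coverable_subset; [| |apply (coverable_preimage
             (fun y => inA c (sidx i0 l) y /\ avoids_switch beta y) beta (t i)); [lra|]].
        -- intros x [_ H]. exact H.
        -- rewrite Rmult_1_l. apply Rle_refl.
        -- replace (beta * (/ (beta - 1) / beta ^ S m)) with (/ (beta - 1) / beta ^ m).
           ++ apply IH, Hl.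
           ++ simpl. field. repeat split; try lra. apply pow_nonzero. lra.
      * exists nil. split; [simpl; lra|]. intros x [H _]. lra.
Qed.

Lemma Ubeta_coverable beta p c i0 k k' t rho u m :
  markov_partition beta p c i0 k k' t -> 0 <= rho ->
  supersolution (p - 2) (Sprime beta c i0) rho u ->
  coverable (Ubeta beta) (/ (beta - 1) / beta ^ m) (rsum (p - 2) u * rho ^ m).
Proof.
  intros Hm Hrho Hu.
  apply (coverable_subset _
    (fun x => exists q, (q < p - 2)%nat /\ (inA c (sidx i0 q) x /\ avoids_switch beta x)) _ _
    (rsum (p - 2) (fun q => u q * rho ^ m))).
  - intros x HU. apply Ubeta_iff in HU; [|apply (mp_golden _ _ _ _ _ _ _ Hm)].
    destruct HU as [Hx Hav]. destruct (domain_inA _ _ _ _ _ _ _ _ Hm Hx) as (i & Hi & HA).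
    destruct (sidx_surj i0 p i) as (q & Hq & E);
      [exact Hi | destruct (mp_i0 _ _ _ _ _ _ _ Hm); lia | |].
    + intros ->. apply (Hav 0%nat). apply (inA_switch _ _ _ _ _ _ _ _ Hm), HA.
    + exists q. rewrite E. auto.
  - rewrite (rsum_ext _ _ (fun q => rho ^ m * u q)) by (intros; ring).
    rewrite rsum_scal. lra.
  - apply coverable_union. intros q Hq. eapply cylinders_cover; eassumption.
Qed.

Lemma infinite_sum_of_bounded f B :
  (forall i, 0 <= f i) -> (forall n, sum_f_R0 f n <= B) ->
  exists S, infinite_sum f S /\ S <= B.
Proof.
  intros Hf HB. destruct (growing_cv (sum_f_R0 f)) as [l Hl].
  - intros n. simpl. specialize (Hf (S n)). lra.
  - exists B. intros x [n ->]. apply HB.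
  - exists l. split; [exact Hl|]. apply Rle_cv_lim with (sum_f_R0 f) (fun _ => B);
      [exact HB | exact Hl | apply Un_cv_const].
Qed.

Lemma sum_geometric_half n : sum_f_R0 (fun i => (1 / 2) ^ i) n <= 2.
Proof.
  assert (sum_f_R0 (fun i => (1 / 2) ^ i) n = 2 - (1 / 2) ^ n).
  { induction n as [|n IH]; [simpl; lra|]. rewrite tech5, IH. simpl. lra. }
  assert (0 < (1 / 2) ^ n) by (apply pow_lt; lra). lra.
Qed.

Lemma sum_first_terms n len a : 0 <= a ->
  sum_f_R0 (fun i => if Nat.ltb i len then a else 0) n <= INR len * a.
Proof.
  intros Ha.
  assert (H : sum_f_R0 (fun i => if Nat.ltb i len then a else 0) n = INR (Nat.min (S n) len) * a).
  { induction n as [|n IH].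
    - simpl. destruct len as [|len]; simpl; lra.
    - rewrite tech5, IH. destruct (Nat.ltb_spec (S n) len) as [Hlt|Hge].
      + rewrite !Nat.min_l by lia. rewrite (S_INR (S n)). ring.
      + rewrite !Nat.min_r by lia. ring. }
  rewrite H. apply Rmult_le_compat_r; [exact Ha | apply le_INR; lia].
Qed.

(* The indices beyond the finite cover carry empty sets, which still need positive diameters
   with a small sum of [s]-th powers. *)
Lemma hausdorff_null_of_coverable s E : 0 < s ->
  (forall delta eps, 0 < delta -> 0 < eps ->
     exists d B, 0 < d <= delta /\ coverable E d B /\ B * Rpower d s < eps) ->
  hausdorff_null s E.
Proof.
  intros Hs H delta eps Hdelta Heps.
  destruct (H delta (eps / 2) Hdelta ltac:(lra)) as (d & B & Hd & (l & Hl & Hcov) & HB).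
  assert (Hpw : forall x, 0 < Rpower x s) by (intros; apply exp_pos).
  (* The [s]-th power of [small i] is at most [eps / 8 * (1 / 2) ^ i]. These sum to at most
     [eps / 4], and the actual cover costs less than [eps / 2]. *)
  set (small := fun i => Rmin delta (Rpower (eps / 8 * (1 / 2) ^ i) (/ s))).
  assert (Hhalf : forall i, 0 < eps / 8 * (1 / 2) ^ i).
  { intros i. apply Rmult_lt_0_compat; [lra | apply pow_lt; lra]. }
  assert (Hsmall : forall i, 0 < small i <= delta /\ Rpower (small i) s <= eps / 8 * (1 / 2) ^ i).
  { intros i. assert (0 < Rpower (eps / 8 * (1 / 2) ^ i) (/ s)) by apply exp_pos.
    assert (Hpos : 0 < small i) by (apply Rmin_glb_lt; assumption).
    split; [split; [exact Hpos | apply Rmin_l]|].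
    eapply Rle_trans; [apply Rle_Rpower_l; [lra | split; [exact Hpos | apply Rmin_r]]|].
    rewrite Rpower_mult, Rinv_l, Rpower_1 by (try apply Hhalf; lra). lra. }
  exists (fun i x => (i < length l)%nat /\ nth i l 0 <= x <= nth i l 0 + d).
  exists (fun i => if Nat.ltb i (length l) then d else small i). split; [|split].
  - intros x Hx. destruct (Hcov x Hx) as (a & Ha & Hax).
    destruct (In_nth l a 0 Ha) as (i & Hi & <-). exists i. auto.
  - intros i. destruct (Nat.ltb_spec i (length l)) as [Hlt|Hge].
    + split; [exact Hd|]. intros x y [_ Hx] [_ Hy]. apply Rabs_le. lra.
    + split; [apply Hsmall|]. intros x y [Hi _]. lia.
  - set (f := fun i => Rpower (if Nat.ltb i (length l) then d else small i) s).
    destruct (infinite_sum_of_bounded f (eps / 2 + eps / 4)) as (S & HS & HSB).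
    + intros i. left. apply Hpw.
    + intros n.
      apply Rle_trans with (sum_f_R0 (fun i =>
        (if Nat.ltb i (length l) then Rpower d s else 0) + eps / 8 * (1 / 2) ^ i) n).
      * apply sum_Rle. intros i _. unfold f. specialize (Hhalf i).
        destruct (Nat.ltb i (length l)); [lra|].
        destruct (Hsmall i) as [_ Hi]. lra.
      * rewrite sum_plus.
        assert (H1 := sum_first_terms n (length l) (Rpower d s) ltac:(left; apply Hpw)).
        assert (INR (length l) * Rpower d s <= B * Rpower d s)
          by (apply Rmult_le_compat_r; [left; apply Hpw | exact Hl]).
        assert (H2 : sum_f_R0 (fun i => eps / 8 * (1 / 2) ^ i) n <= eps / 8 * 2).
        { rewrite (sum_eq _ (fun i => (1 / 2) ^ i * (eps / 8))) by (intros; ring).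
          rewrite <- scal_sum. apply Rmult_le_compat_l; [lra | apply sum_geometric_half]. }
        lra.
    + exists S. split; [exact HS | lra].
Qed.

Lemma Rpower_inv_pow x n s : 0 < x -> Rpower (/ x ^ n) s = / Rpower x s ^ n.
Proof.
  intros Hx. rewrite <- (Rpower_pow n x Hx), <- Rpower_Ropp, Rpower_mult.
  rewrite <- (Rpower_pow n (Rpower x s)) by apply exp_pos.
  rewrite Rpower_mult, <- Rpower_Ropp. f_equal. ring.
Qed.

(** With [rho] strictly between [r] and [beta ^ s], the count times the [s]-th power of the length
    is a constant times [(rho / beta ^ s) ^ m], which tends to 0. *)
Lemma Ubeta_null_above beta p c i0 k k' t r s :
  markov_partition beta p c i0 k k' t -> 1 <= r ->
  (forall rho, r < rho -> exists u, supersolution (p - 2) (Sprime beta c i0) rho u) ->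
  ln r / ln beta < s -> hausdorff_null s (Ubeta beta).
Proof.
  intros Hm Hr Hsup Hs.
  assert (Hb : 1 < beta) by apply (mp_golden _ _ _ _ _ _ _ Hm).
  assert (Hlnb : 0 < ln beta) by (rewrite <- ln_1; apply ln_increasing; lra).
  assert (Hlnr : 0 <= ln r).
  { rewrite <- ln_1. destruct Hr as [Hr|<-]; [left; apply ln_increasing; lra | lra]. }
  assert (Hs0 : 0 < s).
  { eapply Rle_lt_trans; [|exact Hs]. apply Rmult_le_pos; [exact Hlnr|].
    left. apply Rinv_0_lt_compat, Hlnb. }
  assert (Hrs : r < Rpower beta s).
  { rewrite <- (exp_ln r) by lra. unfold Rpower. apply exp_increasing.
    apply Rmult_lt_reg_r with (/ ln beta); [apply Rinv_0_lt_compat, Hlnb|].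
    rewrite Rmult_assoc, Rinv_r by lra. lra. }
  set (bs := Rpower beta s) in *. set (rho := (r + bs) / 2).
  destruct (Hsup rho) as [u Hu]; [unfold rho; lra|].
  assert (Hrho : 0 <= rho) by (unfold rho; lra).
  set (L := / (beta - 1)). assert (HL : 0 < L) by (apply Rinv_0_lt_compat; lra).
  apply hausdorff_null_of_coverable; [exact Hs0|]. intros delta eps Hdelta Heps.
  set (C := rsum (p - 2) u * Rpower L s).
  assert (HC : 0 <= C).
  { apply Rmult_le_pos; [|left; apply exp_pos]. apply rsum_nonneg. intros i Hi.
    destruct (Hu i Hi). lra. }
  destruct (inv_pow_small beta (delta / L) Hb) as [N1 HN1]; [apply Rdiv_lt_0_compat; lra|].
  destruct (inv_pow_small (bs / rho) (eps / (C + 1))) as [N2 HN2].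
  { apply Rmult_lt_reg_r with rho; [unfold rho; lra|]. unfold Rdiv.
    rewrite Rmult_assoc, Rinv_l by (unfold rho; lra). unfold rho. lra. }
  { apply Rdiv_lt_0_compat; lra. }
  set (m := (N1 + N2)%nat). specialize (HN1 m ltac:(lia)). specialize (HN2 m ltac:(lia)).
  assert (Hbm : 0 < / beta ^ m) by (apply Rinv_0_lt_compat, pow_lt; lra).
  exists (L / beta ^ m), (rsum (p - 2) u * rho ^ m). split; [|split].
  - split; [apply Rmult_lt_0_compat; lra|].
    replace delta with (L * (delta / L)) by (field; lra).
    apply Rmult_le_compat_l; lra.
  - eapply Ubeta_coverable; eassumption.
  - unfold Rdiv. rewrite <- Rpower_mult_distr by lra. rewrite Rpower_inv_pow by lra. fold bs.
    replace (rsum (p - 2) u * rho ^ m * (Rpower L s * / bs ^ m)) with (C * / (bs / rho) ^ m).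
    + apply Rle_lt_trans with (C * (eps / (C + 1))); [apply Rmult_le_compat_l; lra|].
      replace (C * (eps / (C + 1))) with (eps - eps / (C + 1)) by (field; lra).
      assert (0 < eps / (C + 1)) by (apply Rdiv_lt_0_compat; lra). lra.
    + assert (Hr0 : 0 < rho) by (unfold rho; lra).
      assert (Hbs : bs <> 0) by lra.
      unfold C, Rdiv. rewrite Rpow_mult_distr, pow_inv.
      field. split; apply pow_nonzero; lra.
Qed.

(** * Lower bound *)

(* The set of [t] with [t <= sum_(i<n) |J_i cap (-oo,t]|] for some [n] is pushed to the right
   across any open interval [J_m] that it meets, so its supremum is [V]. *)
Lemma interval_cover_length V (a b : nat -> R) S0 : 0 <= V ->
  (forall i, a i <= b i) ->
  (forall t, 0 <= t <= V -> exists i, a i < t < b i) ->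
  (forall n, rsum n (fun i => b i - a i) <= S0) -> V <= S0.
Proof.
  intros HV Hab Hcov HS.
  set (g := fun t i => Rmax 0 (Rmin t (b i) - a i)).
  assert (Hg0 : forall t i, 0 <= g t i) by (intros; apply Rmax_l).
  assert (Hgle : forall t i, g t i <= b i - a i).
  { intros t i. specialize (Hab i). apply Rmax_lub; [lra|].
    assert (H := Rmin_r t (b i)). lra. }
  assert (Hgmono : forall t t' i, t <= t' -> g t i <= g t' i).
  { intros t t' i Ht. apply Rle_max_compat_l. apply Rplus_le_compat_r.
    apply Rle_min_compat_r, Ht. }
  assert (Hgin : forall t i, a i < t < b i -> g t i = t - a i).
  { intros t i Ht. unfold g. rewrite Rmin_left, Rmax_right by (try rewrite Rmin_left; lra). lra. }
  set (X := fun t => 0 <= t <= V /\ exists n, t <= rsum n (g t)).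
  destruct (completeness X) as [m [Hub Hlub]].
  { exists V. intros t [Ht _]. lra. }
  { exists 0. split; [lra|]. exists 0%nat. simpl. lra. }
  assert (Hm0 : 0 <= m).
  { apply Hub. split; [lra|]. exists 0%nat. simpl. lra. }
  assert (HmV : m <= V) by (apply Hlub; intros t [Ht _]; lra).
  destruct (Hcov m ltac:(lra)) as [q Hq].
  assert (Hex : exists t, X t /\ a q < t).
  { apply NNPP. intros Hc. assert (m <= a q); [|lra]. apply Hlub. intros t Ht.
    apply Rnot_lt_le. intros Hlt. apply Hc. exists t. auto. }
  destruct Hex as (t & HXt & Haq). assert (Htm : t <= m) by (apply Hub, HXt).
  destruct HXt as [Ht [n Hn]].
  set (N := (n + S q)%nat).
  assert (Hpush : forall t', t <= t' < b q -> t' <= rsum N (g t')).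
  { intros t' Ht'.
    assert (H1 : t <= rsum N (g t)).
    { eapply Rle_trans; [exact Hn|]. apply rsum_mono; [apply Hg0 | unfold N; lia]. }
    assert (H2 : g t' q - g t q <= rsum N (fun i => g t' i - g t i)).
    { apply (rsum_term_le N (fun i => g t' i - g t i)); [|unfold N; lia].
      intros j _. assert (H := Hgmono t t' j (proj1 Ht')). lra. }
    rewrite (rsum_ext N (fun i => g t' i - g t i) (fun i => g t' i + (-1) * g t i)) in H2
      by (intros; ring).
    rewrite rsum_plus, rsum_scal in H2.
    rewrite (Hgin t' q), (Hgin t q) in H2 by lra.
    change (rsum N (fun i => g t' i)) with (rsum N (g t')) in H2.
    change (rsum N (fun i => g t i)) with (rsum N (g t)) in H2. lra. }
  destruct (Rle_dec ((m + b q) / 2) V) as [Hle|Hgt].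
  - assert ((m + b q) / 2 <= m); [|lra]. apply Hub. split; [lra|]. exists N. apply Hpush. lra.
  - apply Rle_trans with (rsum N (g V)); [apply Hpush; lra|].
    apply Rle_trans with (rsum N (fun i => b i - a i)); [|apply HS].
    apply rsum_le. intros. apply Hgle.
Qed.

(** Merges two countable families of intervals into one cover: the images of the sets covering
    [U_beta], and small intervals around the exceptional values of [Phi]. *)
Definition interleave {A} (f g : nat -> A) (n : nat) : A :=
  if Nat.even n then f (Nat.div2 n) else g (Nat.div2 n).

Lemma interleave_even {A} (f g : nat -> A) n : interleave f g (2 * n) = f n.
Proof.
  unfold interleave. rewrite Nat.even_mul. simpl orb. cbv iota. rewrite Nat.div2_double.
  reflexivity.
Qed.

Lemma interleave_odd {A} (f g : nat -> A) n : interleave f g (S (2 * n)) = g n.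
Proof.
  unfold interleave. rewrite Nat.even_succ, Nat.odd_mul. simpl andb. cbv iota.
  rewrite Nat.div2_succ_double. reflexivity.
Qed.

Lemma rsum_interleave f g n : rsum (2 * n) (interleave f g) = rsum n f + rsum n g.
Proof.
  induction n as [|n IH]; [simpl; ring|].
  replace (2 * S n)%nat with (S (S (2 * n))) by lia.
  change (rsum (2 * n) (interleave f g) + interleave f g (2 * n) + interleave f g (S (2 * n))
          = rsum n f + f n + (rsum n g + g n)).
  rewrite IH, interleave_even, interleave_odd. ring.
Qed.

Lemma rsum_le_infinite_sum f S0 n :
  (forall i, 0 <= f i) -> infinite_sum f S0 -> rsum n f <= S0.
Proof.
  intros Hf HS. assert (E : forall k, sum_f_R0 f k = rsum (S k) f).
  { induction k as [|k IH]; [simpl; ring|]. rewrite tech5, IH. reflexivity. }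
  apply Rle_trans with (rsum (S n) f); [apply rsum_mono; [exact Hf | lia]|].
  rewrite <- E. apply sum_incr; assumption.
Qed.

(* [P] is the distribution function, at the partition points, of the Perron eigenvector; the
   identities below say that this measure scales by [r] under [T^(i)] and gives the switch
   region no mass. *)
Record perron_distribution r p i0 (k k' : nat -> nat) (P : nat -> R) : Prop := {
  pd_scale : forall i, (1 <= i < p)%nat -> i <> i0 -> P (k' i) - P (k i) = r * (P (S i) - P i);
  pd_switch : P (S i0) = P i0;
  pd_bounded : exists M, 0 <= M /\ forall i, Rabs (P i) <= M
}.

(** Self-similarity: over a cell, [Phi] is a copy of itself over the image of the cell, scaled by
    [1 / r]. Continuity is not a field; it follows from these equations. *)
Record distribution_function beta r p c i0 (k : nat -> nat) t P B (Phi : R -> R) : Prop := {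
  df_bound : forall x, Rabs (Phi x) <= B;
  df_node : forall j, (1 <= j <= p)%nat -> Phi (c j) = P j;
  df_scale : forall i x, (1 <= i < p)%nat -> i <> i0 -> inA c i x ->
    Phi x = P i + / r * (Phi (beta * x - t i) - P (k i));
  df_switch : forall x, inA c i0 x -> Phi x = P i0
}.

(** [Phi] is the fixed point of [step], which contracts bounded functions by [1 / r]. Values at
    partition points are prescribed rather than computed, so that the two cells meeting there cannot
    conflict. *)
Lemma distribution_function_exists beta r p c i0 k k' t P :
  markov_partition beta p c i0 k k' t -> 1 < r -> perron_distribution r p i0 k k' P ->
  exists B Phi, distribution_function beta r p c i0 k t P B Phi.
Proof.
  intros Hm Hr HP. destruct (pd_bounded _ _ _ _ _ _ HP) as (M & HM0 & HM).
  (* Outside the domain [idx] is an arbitrary index, which is why [pd_bounded] concerns all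
     indices. *)
  set (idx := fun x => epsilon (inhabits 0%nat) (fun i => (1 <= i < p)%nat /\ inA c i x)).
  set (is_node := fun x j => (1 <= j <= p)%nat /\ c j = x).
  set (step := fun (f : R -> R) x =>
    if excluded_middle_informative (exists j, is_node x j)
    then P (epsilon (inhabits 0%nat) (is_node x))
    else if Nat.eq_dec (idx x) i0 then P i0
    else P (idx x) + / r * (f (beta * x - t (idx x)) - P (k (idx x)))).
  assert (Hir : 0 < / r < 1).
  { split; [apply Rinv_0_lt_compat; lra|]. rewrite <- Rinv_1. apply Rinv_lt_contravar; lra. }
  (* In all three cases [step f x] depends on a single value of [f], affinely and with slope at most
     [1 / r]; boundedness, contraction and passage to the limit are read off this form. *)
  assert (Haff : forall x, exists A q y, Rabs A <= M + / r * M /\ 0 <= q <= / r /\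
            forall f, step f x = A + q * f y).
  { intros x. assert (Hpos : 0 <= / r * M) by (apply Rmult_le_pos; lra). unfold step.
    destruct (excluded_middle_informative _).
    - exists (P (epsilon (inhabits 0%nat) (is_node x))), 0, 0.
      repeat split; try lra; [|intros; ring].
      specialize (HM (epsilon (inhabits 0%nat) (is_node x))). lra.
    - destruct (Nat.eq_dec (idx x) i0).
      + exists (P i0), 0, 0. repeat split; try lra; [|intros; ring]. specialize (HM i0). lra.
      + exists (P (idx x) - / r * P (k (idx x))), (/ r), (beta * x - t (idx x)).
        repeat split; try lra; [|intros; ring].
        unfold Rminus. eapply Rle_trans; [apply Rabs_triang|].
        rewrite Rabs_Ropp, Rabs_mult, (Rabs_pos_eq (/ r)) by lra.
        apply Rplus_le_compat; [apply HM | apply Rmult_le_compat_l; [lra | apply HM]]. }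
  (* The solution of [B = M + M / r + B / r], so the functions bounded by [B] are preserved by
     [step]. *)
  set (B := (M + / r * M) / (1 - / r)).
  assert (HB0 : 0 <= B).
  { apply Rmult_le_pos; [|left; apply Rinv_0_lt_compat; lra].
    assert (0 <= / r * M) by (apply Rmult_le_pos; lra). lra. }
  assert (HB : M + / r * M + / r * B = B) by (unfold B; field; lra).
  set (F := fun n => Nat.iter n step (fun _ => 0)).
  assert (HFB : forall n x, Rabs (F n x) <= B).
  { induction n as [|n IH]; intros x; [simpl; rewrite Rabs_R0; exact HB0|].
    change (F (S n) x) with (step (F n) x).
    destruct (Haff x) as (A & q & y & HA & Hq & ->).
    eapply Rle_trans; [apply Rabs_triang|]. rewrite Rabs_mult, (Rabs_pos_eq q) by lra.
    assert (q * Rabs (F n y) <= / r * B).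
    { apply Rmult_le_compat; [lra | apply Rabs_pos | lra | apply IH]. }
    lra. }
  assert (Hcontr : forall n f, (forall x, Rabs (f x) <= B) -> forall x,
            Rabs (Nat.iter n step f x - F n x) <= B * / r ^ n).
  { induction n as [|n IH]; intros f Hf x.
    - simpl. rewrite Rminus_0_r, Rinv_1, Rmult_1_r. apply Hf.
    - change (Rabs (step (Nat.iter n step f) x - step (F n) x) <= B * / r ^ S n).
      destruct (Haff x) as (A & q & y & _ & Hq & Hstep). rewrite !Hstep.
      replace (A + q * Nat.iter n step f y - (A + q * F n y))
        with (q * (Nat.iter n step f y - F n y)) by ring.
      rewrite Rabs_mult, (Rabs_pos_eq q) by lra.
      replace (B * / r ^ S n) with (/ r * (B * / r ^ n))
        by (simpl; field; split; [apply pow_nonzero; lra | lra]).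
      apply Rmult_le_compat; [lra | apply Rabs_pos | lra | apply IH, Hf]. }
  assert (Hlim : forall x, exists l, Un_cv (fun n => F n x) l).
  { intros x. destruct (R_complete (fun n => F n x)) as [l Hl]; [|exists l; exact Hl].
    intros eps Heps.
    destruct (inv_pow_small r (eps / (2 * B + 1)) Hr) as [N HN].
    { apply Rdiv_lt_0_compat; lra. }
    exists N. specialize (HN N (le_n N)).
    assert (HN' : 2 * B * / r ^ N < eps).
    { assert (0 < / r ^ N) by (apply Rinv_0_lt_compat, pow_lt; lra).
      apply Rle_lt_trans with ((2 * B + 1) * / r ^ N).
      - apply Rmult_le_compat_r; lra.
      - replace eps with ((2 * B + 1) * (eps / (2 * B + 1))) by (field; lra).
        apply Rmult_lt_compat_l; lra. }
    assert (Hd : forall n, (n >= N)%nat -> Rabs (F n x - F N x) <= B * / r ^ N).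
    { intros n Hn. replace n with (N + (n - N))%nat by lia. unfold F at 1.
      rewrite Nat.iter_add. apply Hcontr. apply HFB. }
    intros n n' Hn Hn'. unfold Rdist.
    replace (F n x - F n' x) with ((F n x - F N x) + - (F n' x - F N x)) by ring.
    eapply Rle_lt_trans; [apply Rabs_triang|]. rewrite Rabs_Ropp.
    specialize (Hd n Hn) as H1. specialize (Hd n' Hn') as H2. lra. }
  destruct (ClassicalEpsilon.choice _ Hlim) as [Phi HPhi].
  assert (Hfix : forall x, Phi x = step Phi x).
  { intros x. apply UL_sequence with (fun n => F (S n) x).
    - apply (Un_cv_ext (fun n => F (n + 1)%nat x)).
      + intros n. replace (n + 1)%nat with (S n) by lia. reflexivity.
      + apply (CV_shift' (fun n => F n x) 1), HPhi.
    - destruct (Haff x) as (A & q & y & _ & _ & Hstep). rewrite Hstep.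
      apply (Un_cv_ext (fun n => A + q * F n y)).
      + intros n. symmetry. exact (Hstep (F n)).
      + apply CV_plus; [apply Un_cv_const|]. apply CV_mult; [apply Un_cv_const | apply HPhi]. }
  assert (Hincr := mp_incr _ _ _ _ _ _ _ Hm).
  assert (Hidx := index_lt_of_value_lt p c Hincr).
  assert (Hnode : forall j, (1 <= j <= p)%nat -> Phi (c j) = P j).
  { intros j Hj. rewrite Hfix. unfold step.
    destruct (excluded_middle_informative _) as [Hex|Hn].
    - f_equal. destruct (epsilon_spec (inhabits 0%nat) _ Hex) as [Hj' E].
      set (j' := epsilon (inhabits 0%nat) (is_node (c j))) in *.
      destruct (Nat.lt_trichotomy j' j) as [Hlt|[->|Hgt]]; [|reflexivity|].
      + assert (c j' < c j) by (apply Hincr; lia). lra.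
      + assert (c j < c j') by (apply Hincr; lia). lra.
    - exfalso. apply Hn. exists j. split; auto. }
  (* Both endpoints of a cell satisfy its functional equation, by [pd_scale] and [pd_switch]. *)
  assert (Hcell : forall i x, (1 <= i < p)%nat -> inA c i x ->
     x = c i \/ x = c (S i) \/ (~ (exists j, is_node x j) /\ idx x = i)).
  { intros i x Hi HA. assert (HA' := HA). destruct HA' as [H1 H2].
    destruct (Req_dec x (c i)) as [|Hne1]; [auto|].
    destruct (Req_dec x (c (S i))) as [|Hne2]; [auto|]. right. right. split.
    - intros (j & Hj & E).
      assert (i < j)%nat by (apply Hidx; try lia; lra).
      assert (j < S i)%nat by (apply Hidx; try lia; lra). lia.
    - assert (Hspec : (1 <= idx x < p)%nat /\ inA c (idx x) x).
      { apply (epsilon_spec (inhabits 0%nat) (fun i => (1 <= i < p)%nat /\ inA c i x)).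
        exists i. auto. }
      destruct Hspec as [Hr1 [H3 H4]]. set (i' := idx x) in *.
      assert (i < S i')%nat by (apply Hidx; try lia; lra).
      assert (i' < S i)%nat by (apply Hidx; try lia; lra). lia. }
  exists B, Phi. constructor.
  - intros x. apply Rabs_le. split.
    + apply Rle_cv_lim with (fun _ => - B) (fun n => F n x); [|apply Un_cv_const | apply HPhi].
      intros n. assert (H := HFB n x). apply Rabs_le_between in H. lra.
    + apply Rle_cv_lim with (fun n => F n x) (fun _ => B); [|apply HPhi | apply Un_cv_const].
      intros n. assert (H := HFB n x). apply Rabs_le_between in H. lra.
  - exact Hnode.
  - intros i x Hi Hne HA.
    destruct (mp_image _ _ _ _ _ _ _ Hm i Hi Hne) as (Hk & Hk' & E & E').
    destruct (Hcell i x Hi HA) as [->|[->|[Hn Ei]]].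
    + rewrite <- E, !Hnode by lia. ring.
    + rewrite <- E', !Hnode by lia. rewrite (pd_scale _ _ _ _ _ _ HP i Hi Hne). field. lra.
    + rewrite Hfix at 1. unfold step. rewrite Ei.
      destruct (excluded_middle_informative _); [contradiction|].
      destruct (Nat.eq_dec i i0); [contradiction | reflexivity].
  - intros x HA. destruct (mp_i0 _ _ _ _ _ _ _ Hm) as [H1 H2].
    destruct (Hcell i0 x ltac:(lia) HA) as [->|[->|[Hn Ei]]].
    + apply Hnode. lia.
    + rewrite Hnode by lia. apply (pd_switch _ _ _ _ _ _ HP).
    + rewrite Hfix. unfold step. rewrite Ei.
      destruct (excluded_middle_informative _); [contradiction|].
      destruct (Nat.eq_dec i0 i0); [reflexivity | contradiction].
Qed.

Lemma positive_lower_bound n f : (forall i, (i < n)%nat -> 0 < f i) ->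
  exists l, 0 < l /\ forall i, (i < n)%nat -> l <= f i.
Proof.
  induction n as [|n IH]; intros H.
  - exists 1. split; [lra | intros; lia].
  - destruct IH as (l & Hl & Hle); [intros; apply H; lia|].
    exists (Rmin l (f n)). split; [apply Rmin_glb_lt; [exact Hl | apply H; lia]|].
    intros i Hi. destruct (Nat.eq_dec i n) as [->|Hne]; [apply Rmin_r|].
    eapply Rle_trans; [apply Rmin_l | apply Hle; lia].
Qed.

Lemma distribution_same_cell beta r p c i0 k k' t P B Phi i x y :
  markov_partition beta p c i0 k k' t -> 1 < r ->
  distribution_function beta r p c i0 k t P B Phi ->
  (1 <= i < p)%nat -> inA c i x -> inA c i y ->
  (i = i0 /\ Phi x = Phi y) \/
  (i <> i0 /\ Phi x - Phi y = / r * (Phi (beta * x - t i) - Phi (beta * y - t i))).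
Proof.
  intros Hm Hr HD Hi Hx Hy. destruct (Nat.eq_dec i i0) as [->|Hne].
  - left. split; [reflexivity|]. rewrite !(df_switch _ _ _ _ _ _ _ _ _ _ HD) by assumption.
    reflexivity.
  - right. split; [exact Hne|]. rewrite (df_scale _ _ _ _ _ _ _ _ _ _ HD i x Hi Hne Hx).
    rewrite (df_scale _ _ _ _ _ _ _ _ _ _ HD i y Hi Hne Hy). ring.
Qed.

(* A short interval is blown up by the [T^(i)] until it contains a partition point; from then
   on it is compared with that point, whose images are partition points again.  Comparing with
   such a point avoids losing a constant factor at each step. *)
Lemma distribution_holder beta r p c i0 k k' t P B Phi :
  markov_partition beta p c i0 k k' t -> 1 < r ->
  distribution_function beta r p c i0 k t P B Phi ->
  exists l, 0 < l /\ forall n x y, domain beta x -> domain beta y ->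
    Rabs (x - y) <= l / beta ^ n -> Rabs (Phi x - Phi y) <= 4 * B / r ^ n.
Proof.
  intros Hm Hr HD.
  assert (Hb : 1 < beta) by apply (mp_golden _ _ _ _ _ _ _ Hm).
  assert (Hincr := mp_incr _ _ _ _ _ _ _ Hm).
  destruct (mp_i0 _ _ _ _ _ _ _ Hm) as [Hi0 Hi0p].
  destruct (positive_lower_bound (p - 1) (fun i => c (S (S i)) - c (S i))) as (l & Hl & Hgap).
  { intros i Hi. assert (c (S i) < c (S (S i))) by (apply Hincr; lia). lra. }
  assert (Hgap' : forall i, (1 <= i < p)%nat -> l <= c (S i) - c i).
  { intros i Hi. specialize (Hgap (i - 1)%nat ltac:(lia)).
    replace (S (i - 1)) with i in Hgap by lia. exact Hgap. }
  assert (HB2 : forall x y, Rabs (Phi x - Phi y) <= 2 * B).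
  { intros x y. unfold Rminus. eapply Rle_trans; [apply Rabs_triang|]. rewrite Rabs_Ropp.
    assert (H1 := df_bound _ _ _ _ _ _ _ _ _ _ HD x).
    assert (H2 := df_bound _ _ _ _ _ _ _ _ _ _ HD y). lra. }
  assert (HB0 : 0 <= B) by (assert (H := HB2 0 0); assert (H' := Rabs_pos (Phi 0 - Phi 0)); lra).
  assert (Hpow : forall n, 0 < / beta ^ n <= 1).
  { intros n. assert (1 <= beta ^ n) by (apply pow_R1_Rle; lra).
    split; [apply Rinv_0_lt_compat; lra|]. rewrite <- Rinv_1. apply Rinv_le_contravar; lra. }
  assert (Hshort : forall n, l / beta ^ n <= l).
  { intros n. unfold Rdiv. rewrite <- (Rmult_1_r l) at 2. apply Rmult_le_compat_l; [lra|].
    apply Hpow. }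
  assert (Hexp : forall i n x y, Rabs (x - y) <= l / beta ^ S n ->
            Rabs (beta * x - t i - (beta * y - t i)) <= l / beta ^ n).
  { intros i n x y H. replace (beta * x - t i - (beta * y - t i)) with (beta * (x - y)) by ring.
    rewrite Rabs_mult, (Rabs_pos_eq beta) by lra.
    replace (l / beta ^ n) with (beta * (l / beta ^ S n))
      by (simpl; field; split; [apply pow_nonzero; lra | lra]).
    apply Rmult_le_compat_l; lra. }
  assert (Hdom : forall i x, (1 <= i < p)%nat -> i <> i0 -> inA c i x -> domain beta (beta * x - t i)).
  { intros i x Hi Hne HA. destruct (image_inA _ _ _ _ _ _ _ _ _ Hm Hi Hne HA) as (j & Hj & HAj).
    destruct (mp_image _ _ _ _ _ _ _ Hm i Hi Hne) as (Hk & Hk' & _ & _).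
    eapply inA_domain; [exact Hm | | exact HAj]. lia. }
  assert (Hscale : forall n C z, 0 <= C -> Rabs z <= C / r ^ n -> Rabs (/ r * z) <= C / r ^ S n).
  { intros n C z HC Hz. assert (0 < / r) by (apply Rinv_0_lt_compat; lra).
    rewrite Rabs_mult, (Rabs_pos_eq (/ r)) by lra.
    replace (C / r ^ S n) with (/ r * (C / r ^ n))
      by (simpl; field; split; [apply pow_nonzero; lra | lra]).
    apply Rmult_le_compat_l; lra. }
  assert (Hnn : forall n C, 0 <= C -> 0 <= C / r ^ n).
  { intros n C HC. apply Rmult_le_pos; [exact HC|]. left. apply Rinv_0_lt_compat, pow_lt. lra. }
  assert (Hnode : forall n j x, (1 <= j <= p)%nat -> domain beta x ->
            Rabs (x - c j) <= l / beta ^ n -> Rabs (Phi x - Phi (c j)) <= 2 * B / r ^ n).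
  { induction n as [|n IH]; intros j x Hj Hx Hd.
    - simpl. replace (2 * B / 1) with (2 * B) by field. apply HB2.
    - assert (Hd' : Rabs (x - c j) <= l) by (specialize (Hshort (S n)); lra).
      apply Rabs_le_between in Hd'.
      destruct (Req_dec x (c j)) as [->|Hne].
      + rewrite Rminus_diag, Rabs_R0. apply Hnn. lra.
      (* No cell is shorter than [l], so [x] lies in a cell with [c j] as an end, and one branch
         acts on both points. *)
      + assert (Hcell : exists i, (1 <= i < p)%nat /\ (j = i \/ j = S i) /\ inA c i x).
        { destruct Hx as [Hx0 HxL]. destruct (Rlt_le_dec x (c j)) as [Hlt|Hge].
          - assert (j <> 1%nat).
            { intros ->. rewrite (mp_first _ _ _ _ _ _ _ Hm) in Hlt. lra. }
            exists (j - 1)%nat. specialize (Hgap' (j - 1)%nat ltac:(lia)).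
            replace (S (j - 1)) with j in Hgap' by lia.
            repeat split; try lia; try lra.
            replace (S (j - 1)) with j by lia. lra.
          - assert (j <> p).
            { intros ->. rewrite (mp_last _ _ _ _ _ _ _ Hm) in *. lra. }
            exists j. specialize (Hgap' j ltac:(lia)). repeat split; try lia; lra. }
        destruct Hcell as (i & Hi & Hji & HA).
        assert (HAj : inA c i (c j)).
        { assert (c i < c (S i)) by (apply Hincr; lia). unfold inA.
          destruct Hji; subst j; lra. }
        destruct (distribution_same_cell _ _ _ _ _ _ _ _ _ _ _ i x (c j) Hm Hr HD Hi HA HAj)
          as [[_ ->]|[Hii ->]].
        * rewrite Rminus_diag, Rabs_R0. apply Hnn. lra.
        * apply Hscale; [lra|].
          destruct (mp_image _ _ _ _ _ _ _ Hm i Hi Hii) as (Hk & Hk' & E & E').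
          specialize (Hexp i n _ _ Hd).
          destruct Hji; subst j; [rewrite <- E in * | rewrite <- E' in *];
            (apply IH; [lia | apply Hdom; assumption | exact Hexp]). }
  exists l. split; [exact Hl|].
  assert (Hord : forall n x y, domain beta x -> domain beta y -> x <= y ->
            Rabs (x - y) <= l / beta ^ n -> Rabs (Phi x - Phi y) <= 4 * B / r ^ n).
  { induction n as [|n IH]; intros x y Hx Hy Hxy Hd.
    - simpl. replace (4 * B / 1) with (4 * B) by field. specialize (HB2 x y). lra.
    (* A partition point between [x] and [y] ends the recursion with two comparisons, whence
       [4 * B]; without one, both points share a cell and can be expanded at no cost. *)
    - destruct (classic (exists j, (1 <= j <= p)%nat /\ x <= c j <= y)) as [(j & Hj & Hxj)|Hno].
      + rewrite Rabs_left1 in Hd by lra.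
        assert (H1 : Rabs (Phi x - Phi (c j)) <= 2 * B / r ^ S n).
        { apply Hnode; [exact Hj | exact Hx |]. rewrite Rabs_left1; lra. }
        assert (H2 : Rabs (Phi y - Phi (c j)) <= 2 * B / r ^ S n).
        { apply Hnode; [exact Hj | exact Hy |]. rewrite Rabs_pos_eq; lra. }
        replace (Phi x - Phi y) with ((Phi x - Phi (c j)) + - (Phi y - Phi (c j))) by ring.
        eapply Rle_trans; [apply Rabs_triang|]. rewrite Rabs_Ropp.
        replace (4 * B / r ^ S n) with (2 * B / r ^ S n + 2 * B / r ^ S n) by lra. lra.
      + destruct (domain_inA _ _ _ _ _ _ _ _ Hm Hx) as (i & Hi & HA).
        assert (HAy : inA c i y).
        { split; [unfold inA in HA; lra|]. apply Rnot_lt_le. intros Hlt. apply Hno.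
          exists (S i). split; [lia|]. unfold inA in HA. lra. }
        destruct (distribution_same_cell _ _ _ _ _ _ _ _ _ _ _ i x y Hm Hr HD Hi HA HAy)
          as [[_ ->]|[Hii ->]].
        * rewrite Rminus_diag, Rabs_R0. apply Hnn. lra.
        * apply Hscale; [lra|]. apply IH; [apply Hdom; assumption | apply Hdom; assumption | |].
          -- assert (beta * x <= beta * y) by (apply mul_beta_le; lra). lra.
          -- apply Hexp, Hd. }
  intros n x y Hx Hy Hd. destruct (Rle_dec x y) as [Hle|Hgt].
  - apply Hord; assumption.
  - rewrite Rabs_minus_sym in Hd |- *. apply Hord; try assumption. lra.
Qed.

Lemma scale_of_length beta l d : 1 < beta -> 0 < d <= l ->
  exists n, l / beta ^ S n < d <= l / beta ^ n.
Proof.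
  intros Hb Hd. destruct (inv_pow_small beta (d / l) Hb) as [N HN].
  { apply Rdiv_lt_0_compat; lra. }
  specialize (HN N (le_n N)).
  assert (HN' : l / beta ^ N < d).
  { replace d with (l * (d / l)) by (field; lra). apply Rmult_lt_compat_l; lra. }
  clear HN. induction N as [|N IH].
  - simpl in HN'. lra.
  - destruct (Rle_dec d (l / beta ^ N)).
    + exists N. split; assumption.
    + apply IH. lra.
Qed.

(** Choose [n] with [l / beta ^ (n + 1) < d <= l / beta ^ n]. Then [1 / r ^ (n + 1)] is at most the
    [s]-th power of [1 / beta ^ (n + 1)], hence of [d / l]; the missing power of [r] and the scale
    [l] go into [K]. *)
Lemma holder_exponent beta r s l C (E : R -> Prop) (Phi : R -> R) :
  1 < beta -> 1 < r -> 0 < l -> 0 <= C -> 0 <= s -> Rpower beta s <= r ->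
  (forall n x y, E x -> E y -> Rabs (x - y) <= l / beta ^ n -> Rabs (Phi x - Phi y) <= C / r ^ n) ->
  exists K, 0 <= K /\ forall d x y, 0 < d <= l -> E x -> E y -> Rabs (x - y) <= d ->
    Rabs (Phi x - Phi y) <= K * Rpower d s.
Proof.
  intros Hb Hr Hl HC Hs0 Hs H.
  exists (C * r * Rpower (/ l) s). split.
  { apply Rmult_le_pos; [apply Rmult_le_pos; lra | left; apply exp_pos]. }
  intros d x y Hd Hx Hy Hxy.
  destruct (scale_of_length beta l d Hb Hd) as (n & Hn1 & Hn2).
  assert (Hrn : 0 < r ^ n) by (apply pow_lt; lra).
  assert (Hil : 0 < / l) by (apply Rinv_0_lt_compat, Hl).
  assert (Hbn : 0 < / beta ^ S n) by (apply Rinv_0_lt_compat, pow_lt; lra).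
  assert (Hbs : 0 < Rpower beta s ^ S n) by (apply pow_lt, exp_pos).
  eapply Rle_trans; [apply (H n x y Hx Hy); lra|].
  replace (C / r ^ n) with (C * r * / r ^ S n)
    by (simpl; field; split; [apply pow_nonzero; lra | lra]).
  rewrite (Rmult_assoc (C * r)). apply Rmult_le_compat_l; [apply Rmult_le_pos; lra|].
  rewrite Rpower_mult_distr by lra.
  apply Rle_trans with (Rpower (/ beta ^ S n) s).
  - rewrite Rpower_inv_pow by lra. apply Rinv_le_contravar; [exact Hbs|].
    apply pow_incr. split; [left; apply exp_pos | exact Hs].
  - apply Rle_Rpower_l; [exact Hs0|]. split; [exact Hbn|].
    apply Rmult_le_reg_l with l; [exact Hl|].
    replace (l * (/ l * d)) with d by (field; lra). unfold Rdiv in Hn1. lra.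
Qed.

(** [IVT_cor] asks for continuity on all of [R]; composing with [clamp] extends [Phi] from the
    domain by constants. *)
Definition clamp a b x := Rmax a (Rmin x b).

Lemma clamp_bounds a b x : a <= b -> a <= clamp a b x <= b.
Proof.
  intros H. unfold clamp. split; [apply Rmax_l | apply Rmax_lub; [exact H | apply Rmin_r]].
Qed.

Lemma clamp_id a b x : a <= x <= b -> clamp a b x = x.
Proof. intros H. unfold clamp. rewrite Rmin_left, Rmax_right; lra. Qed.

Lemma clamp_lipschitz a b x y : Rabs (clamp a b x - clamp a b y) <= Rabs (x - y).
Proof.
  unfold clamp. set (u := Rmin x b). set (v := Rmin y b).
  apply Rle_trans with (Rabs (u - v)).
  - unfold Rmax, Rabs. destruct (Rle_dec a u), (Rle_dec a v);
      repeat match goal with |- context [Rcase_abs ?w] => destruct (Rcase_abs w) end; lra.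
  - unfold u, v, Rmin, Rabs. destruct (Rle_dec x b), (Rle_dec y b);
      repeat match goal with |- context [Rcase_abs ?w] => destruct (Rcase_abs w) end; lra.
Qed.

Lemma distribution_surjective beta r l C (Phi : R -> R) :
  1 < beta -> 1 < r -> 0 < l -> 0 <= C ->
  (forall n x y, domain beta x -> domain beta y -> Rabs (x - y) <= l / beta ^ n ->
     Rabs (Phi x - Phi y) <= C / r ^ n) ->
  forall y, Phi 0 <= y <= Phi (/ (beta - 1)) -> exists x, domain beta x /\ Phi x = y.
Proof.
  intros Hb Hr Hl HC H y Hy. set (L := / (beta - 1)) in *.
  assert (HL : 0 < L) by (apply Rinv_0_lt_compat; lra).
  set (f := fun x => Phi (clamp 0 L x) - y).
  destruct (IVT_cor f 0 L) as (z & Hz & Ez).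
  - intros x. apply continuity_pt_minus; [|apply continuity_pt_const; intros ? ?; reflexivity].
    intros eps Heps.
    destruct (inv_pow_small r (eps / (C + 1)) Hr) as [N HN]; [apply Rdiv_lt_0_compat; lra|].
    specialize (HN N (le_n N)).
    exists (l / beta ^ N). split; [apply Rdiv_lt_0_compat; [exact Hl | apply pow_lt; lra]|].
    intros x' [_ Hx']. simpl in Hx' |- *. unfold Rdist in *.
    apply Rle_lt_trans with (C / r ^ N).
    + apply H; [apply clamp_bounds, Rlt_le, HL | apply clamp_bounds, Rlt_le, HL |].
      eapply Rle_trans; [apply clamp_lipschitz | left; exact Hx'].
    + assert (0 < / r ^ N) by (apply Rinv_0_lt_compat, pow_lt; lra).
      apply Rle_lt_trans with ((C + 1) * / r ^ N).
      * unfold Rdiv. apply Rmult_le_compat_r; lra.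
      * replace eps with ((C + 1) * (eps / (C + 1))) by (field; lra).
        apply Rmult_lt_compat_l; lra.
  - lra.
  - unfold f. rewrite !clamp_id by lra.
    assert (0 <= (y - Phi 0) * (Phi L - y)) by (apply Rmult_le_pos; lra). lra.
  - exists z. split; [exact Hz|]. unfold f in Ez. rewrite clamp_id in Ez by exact Hz. lra.
Qed.

(* Up to the (affine) functional equations, the value at a point whose orbit enters the switch
   region is determined by the finitely many cells visited before. *)
Lemma distribution_off_Ubeta_countable beta r p c i0 k k' t P B Phi :
  markov_partition beta p c i0 k k' t -> distribution_function beta r p c i0 k t P B Phi ->
  exists z : nat -> R, forall x, domain beta x -> ~ Ubeta beta x -> exists n, Phi x = z n.
Proof.
  intros Hm HD.
  (* [N] codes an itinerary of length [m] by Cantor pairing: the current cell, and the code of the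
     rest. *)
  set (zl := fix zl m N := match m with
     | O => P i0
     | S m => P (fst (of_nat N)) + / r * (zl m (snd (of_nat N)) - P (k (fst (of_nat N)))) end).
  assert (HzS : forall m N, zl (S m) N =
    P (fst (of_nat N)) + / r * (zl m (snd (of_nat N)) - P (k (fst (of_nat N))))) by reflexivity.
  exists (fun n => zl (fst (of_nat n)) (snd (of_nat n))). intros x Hx HnU.
  assert (Hg := mp_golden _ _ _ _ _ _ _ Hm).
  assert (Hn : exists n, switch beta (Nat.iter n (Gmap beta) x)).
  { apply NNPP. intros Hc. apply HnU, (Ubeta_iff beta x Hg). split; [exact Hx|].
    intros n Hn. apply Hc. exists n. exact Hn. }
  destruct Hn as [n Hn].
  assert (Hz : exists m N, Phi x = zl m N).
  { clear HnU. revert x Hx Hn. induction n as [|n IH]; intros x Hx Hn.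
    - exists 0%nat, 0%nat. apply (df_switch _ _ _ _ _ _ _ _ _ _ HD).
      apply (inA_switch _ _ _ _ _ _ _ _ Hm), Hn.
    - destruct (classic (switch beta x)) as [Hsw|Hsw].
      + exists 0%nat, 0%nat. apply (df_switch _ _ _ _ _ _ _ _ _ _ HD).
        apply (inA_switch _ _ _ _ _ _ _ _ Hm), Hsw.
      + rewrite Nat.iter_succ_r in Hn.
        destruct (IH (Gmap beta x)) as (m & N & E); [apply Gmap_domain; assumption | exact Hn |].
        destruct (domain_inA _ _ _ _ _ _ _ _ Hm Hx) as (i & Hi & HA).
        assert (Hne : i <> i0).
        { intros ->. apply Hsw, (inA_switch _ _ _ _ _ _ _ _ Hm), HA. }
        exists (S m), (to_nat (i, N)).
        rewrite (df_scale _ _ _ _ _ _ _ _ _ _ HD i x Hi Hne HA).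
        rewrite (mp_map _ _ _ _ _ _ _ Hm i x Hi HA Hsw) in E.
        rewrite HzS, cancel_of_to, E. reflexivity. }
  destruct Hz as (m & N & E). exists (to_nat (m, N)). rewrite cancel_of_to. exact E.
Qed.

Lemma rsum_geometric_half n a : 0 <= a -> rsum n (fun i => a * (1 / 2) ^ i) <= 2 * a.
Proof.
  intros Ha. rewrite (rsum_scal n a (fun i => (1 / 2) ^ i)), (Rmult_comm 2 a). apply Rmult_le_compat_l; [exact Ha|].
  assert (E : rsum n (fun i => (1 / 2) ^ i) = 2 - 2 * (1 / 2) ^ n).
  { induction n as [|n IH]; simpl; [lra | rewrite IH; lra]. }
  assert (0 < (1 / 2) ^ n) by (apply pow_lt; lra). lra.
Qed.

(* Mass distribution principle: a small cover of [U_beta] would be mapped by [Phi] onto a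
   cover, up to a countable set, of an interval of length [P p - P 1] by shorter intervals. *)
Lemma Ubeta_not_null_below beta r p c i0 k k' t P s :
  markov_partition beta p c i0 k k' t -> 1 < r -> perron_distribution r p i0 k k' P ->
  P 1%nat < P p -> 0 <= s -> Rpower beta s <= r -> ~ hausdorff_null s (Ubeta beta).
Proof.
  intros Hm Hr HP HV Hs0 Hs Hnull.
  assert (Hb : 1 < beta) by apply (mp_golden _ _ _ _ _ _ _ Hm).
  destruct (mp_i0 _ _ _ _ _ _ _ Hm) as [Hi0 Hi0p].
  destruct (distribution_function_exists _ _ _ _ _ _ _ _ _ Hm Hr HP) as (B & Phi & HD).
  destruct (distribution_holder _ _ _ _ _ _ _ _ _ _ _ Hm Hr HD) as (l & Hl & Hhold).
  destruct (distribution_off_Ubeta_countable _ _ _ _ _ _ _ _ _ _ _ Hm HD) as [z Hz].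
  assert (HB : 0 <= 4 * B).
  { assert (H := df_bound _ _ _ _ _ _ _ _ _ _ HD 0). assert (H' := Rabs_pos (Phi 0)). lra. }
  assert (E0 : Phi 0 = P 1%nat).
  { rewrite <- (mp_first _ _ _ _ _ _ _ Hm). apply (df_node _ _ _ _ _ _ _ _ _ _ HD). lia. }
  assert (EL : Phi (/ (beta - 1)) = P p).
  { rewrite <- (mp_last _ _ _ _ _ _ _ Hm). apply (df_node _ _ _ _ _ _ _ _ _ _ HD). lia. }
  destruct (holder_exponent beta r s l (4 * B) (domain beta) Phi Hb Hr Hl HB Hs0 Hs Hhold)
    as (K & HK & Hpow).
  set (V := P p - P 1%nat). assert (HV0 : 0 < V) by (unfold V; lra).
  (* This tolerance makes the radii from the cover sum to at most [V / 8]; the two families [eta]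
     add at most [V / 16] each. Doubled, the total length is at most [V / 2]. *)
  destruct (Hnull l (V / (8 * (K + 1))) Hl) as (U & d & HU & Hd & S0 & HS & HSe).
  { apply Rdiv_lt_0_compat; lra. }
  (* The sets [U i] are arbitrary, so each image is centred at the value of [Phi] at some point of
     [U i] in the domain, if there is one. *)
  set (a := fun i => epsilon (inhabits 0) (fun y => exists x, U i x /\ domain beta x /\ Phi x = y)).
  assert (Ha : forall i x, U i x -> domain beta x -> Rabs (Phi x - a i) <= K * Rpower (d i) s).
  { intros i x HUx Hx.
    destruct (epsilon_spec (inhabits 0) (fun y => exists x, U i x /\ domain beta x /\ Phi x = y))
      as (x' & HUx' & Hx' & E); [exists (Phi x), x; auto|].
    unfold a. rewrite <- E. destruct (Hd i) as [Hdi Hdiam]. apply Hpow; auto. }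
  (* These margins make the intervals open and also serve as radii around the countably many
     exceptional values. *)
  set (eta := fun i => V / 32 * (1 / 2) ^ i).
  assert (Heta : forall i, 0 < eta i).
  { intros i. apply Rmult_lt_0_compat; [lra | apply pow_lt; lra]. }
  set (rad := interleave (fun i => K * Rpower (d i) s + eta i) eta).
  set (ctr := interleave a z).
  assert (HKpos : forall i, 0 <= K * Rpower (d i) s).
  { intros i. apply Rmult_le_pos; [exact HK | left; apply exp_pos]. }
  assert (Hrad : forall i, 0 < rad i).
  { intros i. unfold rad, interleave.
    destruct (Nat.even i); [|apply Heta].
    assert (H1 := HKpos (Nat.div2 i)). assert (H2 := Heta (Nat.div2 i)). lra. }
  assert (HVle : V <= V / 2); [|lra].
  apply (interval_cover_length V (fun i => ctr i - P 1%nat - rad i) (fun i => ctr i - P 1%nat + rad i)).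
  - lra.
  - intros i. specialize (Hrad i). lra.
  - intros y Hy.
    assert (Hc : exists i, Rabs (y + P 1%nat - ctr i) < rad i).
    { destruct (distribution_surjective beta r l (4 * B) Phi Hb Hr Hl HB Hhold (y + P 1%nat))
        as (x & Hx & E); [rewrite E0, EL; unfold V in Hy; lra|].
      destruct (classic (Ubeta beta x)) as [HUx|HnU].
      - destruct (HU x HUx) as [i Hi]. exists (2 * i)%nat. unfold rad, ctr.
        rewrite !interleave_even, <- E. specialize (Ha i x Hi Hx). specialize (Heta i). lra.
      - destruct (Hz x Hx HnU) as [i Hi]. exists (S (2 * i)). unfold rad, ctr.
        rewrite !interleave_odd, <- E, Hi, Rminus_diag, Rabs_R0. apply Heta. }
    destruct Hc as [i Hi]. apply Rabs_def2 in Hi. exists i. lra.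
  - intros n.
    rewrite (rsum_ext n _ (fun i => 2 * rad i)) by (intros; ring).
    rewrite rsum_scal.
    assert (H1 : rsum n rad <= rsum (2 * n) rad).
    { apply rsum_mono; [intros; left; apply Hrad | lia]. }
    unfold rad in H1 at 2. rewrite rsum_interleave, rsum_plus, rsum_scal in H1.
    assert (H2 : rsum n eta <= 2 * (V / 32)) by (apply rsum_geometric_half; lra).
    assert (H3 : rsum n (fun i => Rpower (d i) s) <= S0).
    { apply rsum_le_infinite_sum; [intros; left; apply exp_pos | exact HS]. }
    assert (H4 : K * rsum n (fun i => Rpower (d i) s) <= K * (V / (8 * (K + 1)))).
    { apply Rmult_le_compat_l; lra. }
    assert (H5 : K * (V / (8 * (K + 1))) <= V / 8).
    { replace (V / 8) with ((K + 1) * (V / (8 * (K + 1)))) by (field; lra).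
      apply Rmult_le_compat_r; [|lra]. left. apply Rdiv_lt_0_compat; lra. }
    change (fun i => eta i) with eta in H1. lra.
Qed.

Lemma rsum_split a b f : (a <= b)%nat ->
  rsum b f = rsum a f + rsum (b - a) (fun j => f (a + j)%nat).
Proof.
  intros H. replace b with (a + (b - a))%nat at 1 by lia.
  induction (b - a)%nat as [|n IH].
  - rewrite Nat.add_0_r. simpl. ring.
  - rewrite Nat.add_succ_r. simpl. rewrite IH. ring.
Qed.

Lemma rsum_interval n a b f : (a <= b <= n)%nat ->
  rsum n (fun j => (if andb (Nat.leb a j) (Nat.ltb j b) then 1 else 0) * f j)
  = rsum b f - rsum a f.
Proof.
  intros Hab. rewrite (rsum_split b n), (rsum_split a b) by lia.
  rewrite (rsum_ext a _ (fun _ => 0)).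
  2:{ intros j Hj. rewrite (proj2 (Nat.leb_gt _ _)) by lia. simpl. ring. }
  rewrite (rsum_ext (b - a) _ (fun j => f (a + j)%nat)).
  2:{ intros j Hj. rewrite (proj2 (Nat.leb_le _ _)), (proj2 (Nat.ltb_lt _ _)) by lia.
      simpl. ring. }
  rewrite (rsum_ext (n - b) _ (fun _ => 0)).
  2:{ intros j Hj. rewrite (proj2 (Nat.ltb_ge _ _)) by lia. rewrite Bool.andb_false_r. ring. }
  rewrite !rsum_zero, (rsum_split a b f) by lia. ring.
Qed.

(** The eigenvector entries are the masses of the cells and [P] their partial sums. As a row of [S]
    is an interval of ones, the eigenvector equation telescopes into [pd_scale]; the total mass 1 is
    [P p - P 1]. *)
Lemma perron_distribution_exists beta p c i0 k k' t r v :
  markov_partition beta p c i0 k k' t ->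
  (forall q, (q < p - 2)%nat -> 0 <= v q) -> rsum (p - 2) v = 1 ->
  (forall q, (q < p - 2)%nat -> rsum (p - 2) (fun j => Sprime beta c i0 q j * v j) = r * v q) ->
  exists P, perron_distribution r p i0 k k' P /\ P 1%nat < P p.
Proof.
  intros Hm Hv Hv1 Heig. destruct (mp_i0 _ _ _ _ _ _ _ Hm) as [Hi0 Hi0p].
  (* The eigenvector of [S'] with mass 0 inserted at the deleted index [i0]. *)
  set (w := fun j => if Nat.eq_dec j i0 then 0 else
              v (if Nat.ltb j i0 then (j - 1)%nat else (j - 2)%nat)).
  assert (Hw : forall q, w (sidx i0 q) = v q).
  { intros q. unfold w, sidx. destruct (Nat.ltb_spec (S q) i0) as [Hlt|Hge].
    - destruct (Nat.eq_dec (S q) i0); [lia|]. rewrite (proj2 (Nat.ltb_lt _ _)) by lia.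
      f_equal. lia.
    - destruct (Nat.eq_dec (S (S q)) i0); [lia|]. rewrite (proj2 (Nat.ltb_ge _ _)) by lia.
      f_equal. lia. }
  assert (Hwi0 : w i0 = 0) by (unfold w; destruct (Nat.eq_dec i0 i0); [reflexivity | lia]).
  assert (Hw0 : forall j, (1 <= j < p)%nat -> 0 <= w j).
  { intros j Hj. destruct (Nat.eq_dec j i0) as [->|Hne]; [rewrite Hwi0; lra|].
    destruct (sidx_surj i0 p j) as (q & Hq & <-); [lia|lia|exact Hne|].
    rewrite Hw. apply Hv, Hq. }
  assert (Hp : S (p - 2) = (p - 1)%nat) by lia.
  assert (Htot : rsum (p - 1) (fun j => w (S j)) = 1).
  { rewrite <- Hp, <- (rsum_sidx i0 (p - 2) w) by lia. rewrite Hwi0, Rplus_0_r.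
    rewrite (rsum_ext _ _ v) by (intros; apply Hw). exact Hv1. }
  (* Truncating at [p - 1] keeps [P] bounded at indices beyond [p] as well. *)
  set (P := fun i => rsum (Nat.min (i - 1) (p - 1)) (fun j => w (S j))).
  assert (HPS : forall i, (1 <= i < p)%nat -> P (S i) = P i + w i).
  { intros i Hi. unfold P. rewrite !Nat.min_l by lia.
    replace (S i - 1)%nat with (S (i - 1)) by lia. simpl.
    replace (S (i - 1)) with i by lia. reflexivity. }
  exists P. split; [constructor|].
  - intros i Hi Hne. destruct (mp_image _ _ _ _ _ _ _ Hm i Hi Hne) as (Hk & Hk' & _ & _).
    rewrite HPS by exact Hi. replace (P i + w i - P i) with (w i) by ring.
    destruct (sidx_surj i0 p i) as (q & Hq & Eq); [lia|lia|exact Hne|].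
    rewrite <- Eq, Hw, <- (Heig q Hq).
    rewrite (rsum_ext (p - 2) _ (fun j => (fun j => Smat beta c i j * w j) (sidx i0 j))).
    2:{ intros j Hj. simpl. unfold Sprime. rewrite Eq, Hw. reflexivity. }
    assert (H := rsum_sidx i0 (p - 2) (fun j => Smat beta c i j * w j) ltac:(lia)).
    simpl in H. rewrite Hwi0, Rmult_0_r, Rplus_0_r in H. rewrite H.
    change (rsum (p - 2) (fun j => Smat beta c i (S j) * w (S j))
            + Smat beta c i (S (p - 2)) * w (S (p - 2)))
      with (rsum (S (p - 2)) (fun j => Smat beta c i (S j) * w (S j))).
    rewrite Hp.
    rewrite (rsum_ext _ _ (fun j => (if andb (Nat.leb (k i - 1) j) (Nat.ltb j (k' i - 1))
                                     then 1 else 0) * w (S j))).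
    2:{ intros j Hj. rewrite (mp_smat _ _ _ _ _ _ _ Hm) by lia. f_equal.
        destruct (Nat.leb_spec (k i) (S j)); destruct (Nat.leb_spec (k i - 1) j); try lia;
        destruct (Nat.ltb_spec (S j) (k' i)); destruct (Nat.ltb_spec j (k' i - 1)); try lia;
        reflexivity. }
    rewrite (rsum_interval (p - 1) (k i - 1) (k' i - 1) (fun j => w (S j))) by lia.
    rewrite Eq. unfold P. rewrite !Nat.min_l by lia. reflexivity.
  - rewrite HPS by lia. rewrite Hwi0. ring.
  - exists 1. split; [lra|]. intros i.
    assert (Hge : 0 <= P i) by (apply rsum_nonneg; intros; apply Hw0; lia).
    rewrite Rabs_pos_eq by exact Hge. rewrite <- Htot. unfold P.
    rewrite (rsum_split (Nat.min (i - 1) (p - 1)) (p - 1)) by lia.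
    assert (0 <= rsum (p - 1 - Nat.min (i - 1) (p - 1))
                   (fun j => w (S (Nat.min (i - 1) (p - 1) + j)))); [|lra].
    apply rsum_nonneg. intros j Hj. apply Hw0. lia.
  - unfold P. rewrite Nat.min_id, Htot. simpl. lra.
Qed.

(** * The dimension formula from both bounds *)

Theorem theorem4p2 (beta : R)
  (Hbeta : (1 + sqrt 5) / 2 < beta < 2)
  (Hper : greedy_eventually_periodic beta)
  (Hq : quasi_greedy_orbit_avoids beta) :
  exists (p : nat) (c : nat -> R) (i0 : nat),
    enumC beta p c /\
    (1 <= i0 < p)%nat /\ c i0 = / beta /\ c (S i0) = / beta * / (beta - 1) /\
    exists r : R,
      spectral_radius (p - 2) (Sprime beta c i0) r /\
      hausdorff_dim (Ubeta beta) (ln r / ln beta).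
Proof.
  destruct (markov_partition_exists beta (golden_bound beta Hbeta) Hper Hq)
    as (p & c & i0 & k & k' & t & Hc & Hm).
  destruct (mp_i0 _ _ _ _ _ _ _ Hm) as [Hi0 Hi0p].
  assert (Hb : 1 < beta) by apply (mp_golden _ _ _ _ _ _ _ Hm).
  exists p, c, i0. split; [exact Hc|]. split; [lia|].
  split; [apply (mp_switch_left _ _ _ _ _ _ _ Hm)|].
  split; [apply (mp_switch_right _ _ _ _ _ _ _ Hm)|].
  (* Index 0 of [S'] is the leftmost cell, which the branch [beta * x] maps over itself because it
     fixes 0. *)
  assert (Hdiag : Sprime beta c i0 0 0 = 1).
  { unfold Sprime, sidx. rewrite (proj2 (Nat.ltb_lt _ _)) by lia.
    destruct (mp_image _ _ _ _ _ _ _ Hm 1%nat) as (Hk & _); [lia|lia|].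
    rewrite (mp_k1 _ _ _ _ _ _ _ Hm) in Hk.
    rewrite (mp_smat _ _ _ _ _ _ _ Hm), (mp_k1 _ _ _ _ _ _ _ Hm) by lia.
    rewrite (proj2 (Nat.ltb_lt _ _)) by lia. reflexivity. }
  destruct (perron_frobenius (p - 2) (Sprime beta c i0) 0)
    as (r & v & Hr & Hsup & Hv & Hv1 & Heig);
    [intros; apply Sprime_nonneg | lia | lra |].
  exists r. split.
  - apply (spectral_radius_of_perron _ _ r v); try assumption; [intros; apply Sprime_nonneg | lra].
  - assert (Hlnb : 0 < ln beta) by (rewrite <- ln_1; apply ln_increasing; lra).
    split.
    + intros s Hs Hnull. apply Rnot_lt_le. intros Hlt.
      (* For [r = 1] the claimed dimension is 0, which [0 <= s] does not exceed. *)
      assert (Hr1 : 1 < r).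
      { destruct Hr as [Hr|<-]; [exact Hr|exfalso]. rewrite ln_1 in Hlt.
        unfold Rdiv in Hlt. lra. }
      destruct (perron_distribution_exists _ _ _ _ _ _ _ r v Hm Hv Hv1 Heig) as (P & HP & HV).
      refine (Ubeta_not_null_below _ _ _ _ _ _ _ _ _ s Hm Hr1 HP HV Hs _ Hnull).
      rewrite <- (exp_ln r) by lra. left. apply exp_increasing.
      replace (ln r) with (ln r / ln beta * ln beta) by (field; lra).
      apply Rmult_lt_compat_r; assumption.
    + intros b Hlow. apply Rnot_lt_le. intros Hlt.
      assert (Hlnr : 0 <= ln r).
      { rewrite <- ln_1. destruct Hr as [Hr|<-]; [left; apply ln_increasing; lra | lra]. }
      assert (0 <= ln r / ln beta).
      { apply Rmult_le_pos; [exact Hlnr | left; apply Rinv_0_lt_compat, Hlnb]. }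
      set (s := (ln r / ln beta + b) / 2).
      assert (b <= s); [|unfold s in *; lra].
      apply Hlow; [unfold s; lra|].
      apply (Ubeta_null_above _ _ _ _ _ _ _ r s Hm Hr Hsup). unfold s. lra.
Qed.
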